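(* Let $v$ and $t$ be positive integers with $v \equiv 0 \pmod{2t}$. There exists an unparalleled $CS(v,2t)$ if and only if $v>2t>2$.
   Context: A cycle system of a simple graph $\Gamma$ is a set $\mathcal{C}$ of cycles of $\Gamma$ whose edge-sets partition the edge-set $E(\Gamma)$; it is a $k$-cycle system if all its cycles have length $k$ (cycles have length at least $3$). For $v\ge k\ge 3$, a $CS(v,k)$ is a $k$-cycle system of $K_v$ when $v$ is odd, or of $K_v-I$ ($K_v$ minus the edges of a $1$-factor $I$) when $v$ is even; a $CS(v,k)$ is only considered for $v\geq k\geq 3$, so for $k=2$ no $CS(v,k)$ exists. A parallel class of $\mathcal{C}$ is a set of cycles of $\mathcal{C}$ whose vertex-sets partition the vertex-set $V(\Gamma)$. The system $\mathcal{C}$ is unparalleled if it has no parallel class. *)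

(* Defs.v *)
From mathcomp Require Import all_boot.

Set Implicit Arguments.
Unset Strict Implicit.
Unset Printing Implicit Defensive.

(* A simple graph on a finite vertex type [T] is given by its edge-set
   [E : {set {set T}}], whose members are 2-element subsets of [T].  A cycle
   has no isolated vertex, so it is determined by its edge-set
   [c : {set {set T}}]; its length is [#|c|] and its vertex-set is [cover c]. *)

Section Cycles.
Variable T : finType.
Implicit Types (E c I : {set {set T}}) (C P : {set {set {set T}}}).

(* The closing edge is included: [next s] sends the last vertex to the first. *)
Definition cycle_edges (s : seq T) : {set {set T}} :=
  [set [set x; next s x] | x in s].

Definition is_cycle E c : Prop :=
  c \subset E /\
  exists s : seq T, [/\ uniq s, 2 < size s & c = cycle_edges s].

Definition cycle_system E C : Prop :=
  (forall c, c \in C -> is_cycle E c) /\ partition C E.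

Definition k_cycle_system (k : nat) E C : Prop :=
  cycle_system E C /\ forall c, c \in C -> #|c| = k.

Definition one_factor E I : Prop := I \subset E /\ partition I [set: T].

(* Disjointness is required between distinct cycles, not between distinct
   vertex-sets: two different cycles on the same vertices cannot both be in [P],
   which [partition [set cover c | c in P] setT] would allow. *)
Definition parallel_class C P : Prop :=
  [/\ P \subset C,
      {in P &, forall c d, c != d -> [disjoint cover c & cover d]} &
      \bigcup_(c in P) cover c = [set: T]].

Definition unparalleled C : Prop := ~ exists P, parallel_class C P.

End Cycles.

Definition complete_graph (v : nat) : {set {set 'I_v}} :=
  [set e : {set 'I_v} | #|e| == 2].

Definition is_CS (v k : nat) (C : {set {set {set 'I_v}}}) : Prop :=
  [/\ 3 <= k, k <= v &
    if odd v then k_cycle_system k (complete_graph v) C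
    else exists I, one_factor (complete_graph v) I /\
                   k_cycle_system k (complete_graph v :\: I) C].

(* Main.v *)
(** Write [v = 2tm] and [n = tm].  Then [K_v - I] is [K_n] with every vertex [x]
doubled to [(x, 0), (x, 1)] and every edge replaced by a 4-cycle.  Doubling a
path [x_0 .. x_t] of [K_n] gives a graph that splits into two [2t]-cycles, each
through both copies of every inner vertex and one copy of each end.  So a
decomposition of [K_n] into [t]-paths yields a [CS(v, 2t)].

Let [U] be a set of vertices of odd size containing, with the exception below,
both ends of every path: all vertices if [n] is odd, all but one vertex [z] if
[n] is even.  The two cycles
over a path can be chosen to meet [{(x, 0) | x in U}], a set of odd size, in an
even number of vertices, so they cannot partition the vertex-set.  For [n] even
every vertex has odd degree in [K_n], hence [z] is the end of some path, but one
such path is harmless: a cycle through one copy of [z] would have to be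
completed by a cycle over the same path through the other copy, and these two
cycles meet.  If moreover [m] is odd and [t] even, the number of edges of [K_n]
is not divisible by [t]; then one piece is a tripod with three legs of [t/2]
edges, whose doubling splits into three [2t]-cycles, one for each pair of legs.

The path decompositions are rotations of zigzags in [Z_n] ([t] odd), or in
[Z_(n-1)] with an additional point [z] at infinity ([t] even). *)

Require Import Defs.
From mathcomp Require Import all_boot.
From mathcomp.zify Require Import zify_ssreflect.
From Stdlib Require Import ZArith Lia.

Set Implicit Arguments.
Unset Strict Implicit.
Unset Printing Implicit Defensive.

(** * From covering cycles to cycle systems *)

Section CycleEdges.
Variable T : finType.
Implicit Types (s : seq T) (x y : T).

Lemma cover_cycle_edges s : uniq s -> cover (cycle_edges s) = [set x in s].
Proof.
move=> us; apply/setP=> x; rewrite inE; apply/bigcupP/idP.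
  case=> e /imsetP[y ys ->]; rewrite !inE => /orP[/eqP->|/eqP->] //.
  by rewrite mem_next.
by move=> xs; exists [set x; next s x]; [apply: imset_f | rewrite !inE eqxx].
Qed.

Lemma card_cycle_edges_le s : #|cycle_edges s| <= size s.
Proof. by rewrite (leq_trans (leq_imset_card _ _)) ?card_size. Qed.

Lemma next_nth_mod x0 s j :
  uniq s -> j < size s -> next s (nth x0 s j) = nth x0 s (j.+1 %% size s).
Proof.
case: s => // y s us js; rewrite next_nth mem_nth // index_uniq //.
move: js; rewrite /= ltnS leq_eqVlt => /orP[/eqP->|js].
  by rewrite modnn nth_default.
by rewrite modn_small //=; apply: set_nth_default.
Qed.

Lemma cycle_edges_nth x0 s j : uniq s -> j < size s ->
  [set nth x0 s j; nth x0 s (j.+1 %% size s)] \in cycle_edges s.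
Proof.
by move=> us js; rewrite -next_nth_mod //; apply: imset_f; rewrite /= mem_nth.
Qed.

Definition all_pairs : {set {set T}} := [set e : {set T} | #|e| == 2].

(** A 1-factor is encoded by a fixed-point-free involution, the form in which vertex doubling
    supplies it: [mate] will exchange the two copies of a vertex. *)
Definition pairing (mate : T -> T) : {set {set T}} := [set [set x; mate x] | x in T].

Variables (mate : T -> T).
Hypotheses (mateK : involutive mate) (mateN : forall x, mate x != x).

Lemma partition_pairing : partition (pairing mate) [set: T].
Proof.
apply/and3P; split.
- apply/eqP/setP=> x; rewrite inE; apply/bigcupP.
  by exists [set x; mate x]; [apply: imset_f | rewrite !inE eqxx].
- apply/trivIsetP=> _ _ /imsetP[x _ ->] /imsetP[y _ ->] neq.
  rewrite -setI_eq0; apply: contraR neq => /set0Pn[z].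
  have pairE u : z \in [set u; mate u] -> [set u; mate u] = [set z; mate z].
    by rewrite !inE => /orP[/eqP->|/eqP->] //; rewrite mateK setUC.
  by rewrite inE => /andP[/pairE-> /pairE->].
- by apply/imsetP=> -[x _ /setP/(_ x)]; rewrite !inE eqxx.
Qed.

Lemma pairing_sub : pairing mate \subset all_pairs.
Proof.
by apply/subsetP=> _ /imsetP[x _ ->]; rewrite inE cards2 (eq_sym x) mateN.
Qed.

Lemma card_pairing : #|T| = #|pairing mate| * 2.
Proof.
rewrite -cardsT; apply: card_uniform_partition partition_pairing => e.
by move=> /(subsetP pairing_sub); rewrite inE => /eqP.
Qed.

Lemma card_all_pairs_diff : (#|all_pairs :\: pairing mate|).*2 = #|T| * (#|T| - 2).
Proof.
have := cardsD all_pairs (pairing mate).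
rewrite (setIidPr pairing_sub) card_draws => ->.
have := card_pairing; move: #|pairing _| #|T| => a b ->.
by have := mul_bin_diag (a * 2) 1; rewrite bin1; nia.
Qed.

Variables (k : nat) (L : seq (seq T)).
Hypotheses (k_gt2 : 2 < k)
  (L_uniq : forall s, s \in L -> uniq s) (L_size : forall s, s \in L -> size s = k)
  (L_cover : forall x y, y != x -> y != mate x ->
     exists2 s, s \in L & [set x; y] \in cycle_edges s)
  (L_count : (size L * k).*2 <= #|T| * (#|T| - 2)).

Definition edge_sets : {set {set {set T}}} := [set c in [seq cycle_edges s | s <- L]].

Lemma edge_setsP c :
  reflect (exists2 s, s \in L & c = cycle_edges s) (c \in edge_sets).
Proof. by rewrite inE; apply: mapP. Qed.

(* Counting: cycles covering all edges, too few to cover one twice, partition them. *)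
Lemma cycle_system_of_cover :
  k_cycle_system k (all_pairs :\: pairing mate) edge_sets.
Proof.
set E := _ :\: _; set C := edge_sets.
have subE : E \subset cover C.
  apply/subsetP=> e; rewrite in_setD inE => /andP[eI].
  move=> /cards2P[x [y [xy eE]]]; subst e.
  have [||s sL es] := @L_cover x y; first by rewrite eq_sym.
    by apply: contraNneq eI => ->; apply: imset_f.
  by apply/bigcupP; exists (cycle_edges s) => //; apply/edge_setsP; exists s.
have ubC c : c \in C -> #|c| <= k.
  by case/edge_setsP=> s sL ->; rewrite (leq_trans (card_cycle_edges_le _)) ?L_size.
have cardC : #|C| <= size L.
  by rewrite cardsE (leq_trans (card_size _)) ?size_map.
have sumC : \sum_(c in C) #|c| <= #|C| * k.
  by rewrite -sum_nat_const; apply: leq_sum => c /ubC.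
have [covC trivC] := leq_card_cover C.
(* The chain [#|E| <= #|cover C| <= sum of #|c| <= #|C| * k <= size L * k <= #|E|] closes up.
   Equality throughout makes the cycles disjoint, each with exactly [k] edges. *)
have cardE : size L * k <= #|E| by rewrite -leq_double card_all_pairs_diff.
have lekk : #|C| * k <= size L * k by rewrite leq_mul2r cardC orbT.
have coverE : cover C = E.
  apply/esym/eqP; rewrite eqEcard subE /=.
  by rewrite (leq_trans covC) // (leq_trans sumC) // (leq_trans lekk).
move: covC trivC; rewrite coverE => covC trivC.
have cardCk c : c \in C -> #|c| = k.
  move=> cC; apply/eqP; rewrite eqn_leq ubC //= leqNgt; apply/negP=> ltk.
  have : \sum_(c in C) #|c| < #|C| * k.
    rewrite -sum_nat_const (bigD1 c) //= [X in _ < X](bigD1 c) //=.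
    by rewrite -addSn leq_add // leq_sum // => d /andP[/ubC].
  lia.
split=> //; split.
  move=> c cC; split.
    by apply/subsetP=> e ec; rewrite -coverE; apply/bigcupP; exists c.
  by case/edge_setsP: cC => s sL ->; exists s; rewrite L_uniq // L_size.
apply/and3P; split; first by rewrite coverE.
  by rewrite -trivC; lia.
by apply/negP=> /cardCk; rewrite cards0; lia.
Qed.

(** The cycles of a parallel class split [S], so one of them, [s], meets [S] in an odd number of
    points. Its witness [u] must then lie on another cycle of the class, but every cycle through [u]
    meets [s]. *)
Lemma unparalleled_of_parity (S : {set T}) : odd #|S| ->
  (forall s, s \in L -> odd (count (mem S) s) ->
     exists2 u, u \notin s & forall s', s' \in L -> u \in s' -> has (mem s) s') ->
  unparalleled edge_sets.
Proof.
move=> oddS odd_cycle [P [/subsetP PC Pdisj Pcover]].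
have [c cP oc] : exists2 c, c \in P & odd #|S :&: cover c|.
  apply/exists_inP; rewrite -[[exists _ in _, _]]negbK; apply/negP.
  rewrite negb_exists_in => /forall_inP evenP; move: oddS.
  (* Padding with [set0] outside [P] gives a family indexed by all [c] whose members are disjoint
     for any two distinct indices. *)
  pose F c := if c \in P then S :&: cover c else set0.
  have -> : S = \bigcup_c F c.
    apply/setP=> x; apply/idP/bigcupP=> [xS|[c _]]; last first.
      by rewrite /F; case: ifP => _; rewrite inE // => /andP[].
    have := in_setT x; rewrite -Pcover => /bigcupP[c cP xc].
    by exists c; rewrite // /F cP inE xS.
  rewrite -sum1_card partition_disjoint_bigcup => [|c d cd]; last first.
    rewrite /F -setI_eq0; case: ifP => cP; last by rewrite set0I.
    case: ifP => dP; last by rewrite setI0.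
    rewrite setI_eq0; apply: disjointWl (subsetIr _ _) _.
    exact: disjointWr (subsetIr _ _) (Pdisj _ _ cP dP cd).
  apply/negP; apply: (big_ind (fun n => ~~ odd n)) => // [a b|c _].
    by rewrite oddD => /negPf-> /negPf->.
  rewrite sum1_card /F; case: ifP => cP; last by rewrite cards0.
  exact: evenP.
have /edge_setsP[s sL cE] := PC _ cP.
have us := L_uniq sL.
have [||u us' Lu] := odd_cycle s => //.
  move: oc; rewrite cE cover_cycle_edges // -size_filter.
  rewrite -(card_uniqP (filter_uniq _ us)); congr (odd _).
  by apply: eq_card => x; rewrite !inE mem_filter.
have := in_setT u; rewrite -Pcover => /bigcupP[d dP ud].
have /edge_setsP[s' s'L dE] := PC _ dP.
have us2 := L_uniq s'L.
have us'' : u \in s' by move: ud; rewrite dE cover_cycle_edges // inE.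
have cd : c != d.
  by apply: contraNneq us' => cd; move: ud; rewrite -cd cE cover_cycle_edges // inE.
have /hasP[x xs' xs] := Lu _ s'L us''.
have /pred0P/(_ x) := Pdisj _ _ cP dP cd.
by rewrite /= cE dE !cover_cycle_edges // !inE xs' [x \in s]xs.
Qed.
End CycleEdges.

Lemma cycle_edges_map (T W : finType) (g : T -> W) (s : seq T) x y :
  injective g -> uniq s -> [set x; y] \in cycle_edges s ->
  [set g x; g y] \in cycle_edges (map g s).
Proof.
move=> g_inj us /imsetP[z zs xyE]; apply/imsetP; exists (g z).
  by rewrite /= mem_map.
have gE a b : [set g a; g b] = g @: [set a; b] by rewrite imsetU !imset_set1.
by rewrite next_map // !gE xyE.
Qed.

(** Combines the counting and the parity criterion, and transports the result from a convenient
    vertex type to ['I_v] along a bijection. *)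
Lemma exists_unparalleled_CS (T : finType) (mate : T -> T) (v k : nat)
    (L : seq (seq T)) (S : {set T}) :
  involutive mate -> (forall x, mate x != x) -> #|T| = v -> 2 < k -> k <= v ->
  (forall s, s \in L -> uniq s) -> (forall s, s \in L -> size s = k) ->
  (forall x y, y != x -> y != mate x ->
     exists2 s, s \in L & [set x; y] \in cycle_edges s) ->
  (size L * k).*2 <= v * (v - 2) -> odd #|S| ->
  (forall s, s \in L -> odd (count (mem S) s) ->
     exists2 u, u \notin s & forall s', s' \in L -> u \in s' -> has (mem s) s') ->
  exists C : {set {set {set 'I_v}}}, is_CS k C /\ unparalleled C.
Proof.
move=> mateK mateN cardT k_gt2 kv Lu Lsz Lcov Lcount oddS Lodd.
pose g x := cast_ord cardT (enum_rank x).
pose f y := enum_val (cast_ord (esym cardT) y).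
have gK : cancel g f by move=> x; rewrite /f /g cast_ordK enum_rankK.
have fK : cancel f g by move=> x; rewrite /f /g enum_valK cast_ordKV.
have gI := can_inj gK.
pose mate' y := g (mate (f y)).
have mateK' : involutive mate' by move=> y; rewrite /mate' gK mateK fK.
have mateN' y : mate' y != y by rewrite -{2}[y]fK (eqtype.inj_eq gI).
pose L' := map (map g) L.
have Lu' s : s \in L' -> uniq s by case/mapP=> s0 /Lu us ->; rewrite map_inj_uniq.
exists (edge_sets L'); split.
  have /negPf ev : ~~ odd v by rewrite -cardT (card_pairing mateK mateN) oddM andbF.
  split=> //; rewrite ev.
  exists (pairing mate'); split.
    by split; [apply: pairing_sub | apply: partition_pairing].
  apply: cycle_system_of_cover => //.
  - by move=> s /mapP[s0 /Lsz sz ->]; rewrite size_map.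
  - move=> x y yx yx'.
    have [||s sL es] := Lcov (f x) (f y).
    + by rewrite (eqtype.inj_eq (can_inj fK)).
    + by apply: contraNneq yx' => yE; rewrite /mate' -yE fK.
    exists (map g s); first exact: map_f.
    by rewrite -[x]fK -[y]fK cycle_edges_map // Lu.
  - by rewrite size_map card_ord.
apply: (@unparalleled_of_parity _ _ Lu' [set g x | x in S]).
  by rewrite card_imset.
move=> _ /mapP[s sL ->]; rewrite count_map => oc.
have [||u us uL] := Lodd s => //.
  move: oc; congr (odd _); apply: eq_count => x /=.
  by rewrite (mem_imset _ _ gI).
exists (g u); first by rewrite mem_map.
move=> _ /mapP[s' s'L ->]; rewrite mem_map // => /(uL _ s'L)/hasP[x xs' xs].
by apply/hasP; exists (g x); rewrite /= mem_map.
Qed.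

(** On [k] vertices every [k]-cycle is Hamiltonian, hence a parallel class by itself; it remains to
    see that there is a cycle at all. *)
Lemma no_unparalleled_hamiltonian (k : nat) (C : {set {set {set 'I_k}}}) :
  ~~ odd k -> is_CS k C -> ~ unparalleled C.
Proof.
move=> /negPf ek [k_gt2 _]; rewrite ek => -[I [[_ /and3P[_ /trivIsetP Itriv _]]]].
move=> [[Ccyc /and3P[/eqP Ccov _ _]] Ck]; apply.
(* Without cycles every edge would be in [I], but the edges 01 and 02 share a vertex. *)
have [c cC] : exists c, c \in C.
  apply/set0Pn/eqP=> C0; move: Ccov; rewrite C0 /cover big_set0 => /esym/eqP.
  rewrite setD_eq0 => /subsetP sub.
  pose x0 : 'I_k := Ordinal (ltnW (ltnW k_gt2)).
  pose x1 : 'I_k := Ordinal (ltnW k_gt2).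
  pose x2 : 'I_k := Ordinal k_gt2.
  have e1 : [set x0; x1] \in I by apply: sub; rewrite inE cards2.
  have e2 : [set x0; x2] \in I by apply: sub; rewrite inE cards2.
  have := Itriv _ _ e1 e2; rewrite -setI_eq0 => dis.
  have /dis/eqP/setP/(_ x0) : [set x0; x1] != [set x0; x2].
    by apply/eqP=> /setP/(_ x1); rewrite !inE.
  by rewrite !inE eqxx.
exists [set c]; split.
- by rewrite sub1set.
- by move=> d e /set1P-> /set1P->; rewrite eqxx.
rewrite big_set1; have [_ [s [us _ cE]]] := Ccyc _ cC.
rewrite cE cover_cycle_edges //; apply/eqP; rewrite eqEcard subsetT /=.
rewrite cardsT card_ord cardsE (card_uniqP us).
by rewrite -{1}(Ck _ cC) cE card_cycle_edges_le.
Qed.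

(** * Doubling paths *)

Section DoubleCover.
Variables (V : finType) (t : nat).
Hypothesis t_gt1 : 1 < t.

Definition swap_sheet (x : V * bool) := (x.1, ~~ x.2).

(* The cycle that runs along the lift [(p_i, b i)] of [p = p_0 .. p_t] and comes
   back through the other copies of the inner vertices. *)
Definition double_cycle (z0 : V) (p : seq V) (b : nat -> bool) : seq (V * bool) :=
  mkseq (fun j => let i := if j <= t then j else t.*2 - j in
                  (nth z0 p i, b i (+) (t < j))) t.*2.

Definition adj (p : seq V) (x y : V) :=
  exists2 j, j.+1 < size p &
    forall z0, (nth z0 p j = x /\ nth z0 p j.+1 = y) \/
               (nth z0 p j = y /\ nth z0 p j.+1 = x).

Section OneCycle.
Variables (z0 : V) (p : seq V) (b : nat -> bool).
Hypotheses (p_uniq : uniq p) (p_size : size p = t.+1).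
Let c := double_cycle z0 p b.

Lemma size_double_cycle : size c = t.*2.
Proof. by rewrite size_mkseq. Qed.

Lemma double_cycle_uniq : uniq c.
Proof.
apply/(mkseq_uniqP _)=> i j; rewrite !inE => it jt [].
move/eqP; rewrite nth_uniq //; last first.
- by rewrite p_size; case: ifP; lia.
- by rewrite p_size; case: ifP; lia.
move/eqP; do 2 case: ifP; move=> h1 h2 e; rewrite (congr1 b e).
- by [].
- have -> : (t < i) = false by lia.
  have -> : t < j by lia.
  by case: (b _).
- have -> : (t < j) = false by lia.
  have -> : t < i by lia.
  by case: (b _).
- lia.
Qed.

Lemma mem_double_cycle i d : i <= t ->
  ((nth z0 p i, d) \in c) = (0 < i < t) || (d == b i).
Proof.
move=> it; apply/mapP/idP.
  case=> j; rewrite mem_iota => /= jt [] /eqP; rewrite nth_uniq ?p_size //; last first.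
    by case: ifP; lia.
  move=> /eqP iE ->; move: iE; case: ifP => jt' iE; last by apply/orP; left; lia.
  have tj : (t < j) = false by lia.
  by rewrite tj /= addbF iE eqxx orbT.
have [->|db] := eqVneq d (b i).
  move=> _; exists i; first by rewrite mem_iota /=; lia.
  have ti : (t < i) = false by lia.
  by rewrite it ti /= addbF.
rewrite orbF => i0; exists (t.*2 - i); first by rewrite mem_iota /=; lia.
have -> : (t.*2 - i <= t) = false by lia.
have -> : t.*2 - (t.*2 - i) = i by lia.
have -> : t < t.*2 - i by lia.
by rewrite /= addbT; move: db; case: d; case: (b i).
Qed.

Lemma nth_double_cycle w i : i < t.*2 -> nth w c i =
  let k := if i <= t then i else t.*2 - i in (nth z0 p k, b k (+) (t < i)).
Proof. by move=> it; rewrite nth_mkseq. Qed.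

(** A path edge has four lifts; the cycle contains one on the way out and one on the way back, and
    these differ in the sheet of each inner vertex. So an inner edge only constrains [d (+) d'], and
    an end edge only the sheet at the end of the path. *)
Lemma double_cycle_adj j d d' : j < t ->
  (j = 0 -> d = b 0) -> (j.+1 = t -> d' = b t) ->
  (0 < j -> j.+1 < t -> d (+) d' = b j (+) b j.+1) ->
  [set (nth z0 p j, d); (nth z0 p j.+1, d')] \in cycle_edges c.
Proof.
move=> jt h0 ht hj; pose w := (z0, true).
have sc := size_double_cycle.
have up : [set (nth z0 p j, b j); (nth z0 p j.+1, b j.+1)] \in cycle_edges c.
  have jt2 : j.+1 < t.*2 by clear -jt t_gt1; lia.
  have := @cycle_edges_nth _ w _ j double_cycle_uniq.
  rewrite sc (ltnW jt2) modn_small // !nth_double_cycle // ?(ltnW jt2) //= jt (ltnW jt).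
  by rewrite (ltnNge t j) (ltnNge t j.+1) jt (ltnW jt) /= !addbF; apply.
(* The way back crosses this edge between positions [2t - j - 1] and [2t - j]. The terms [0 < j] and
   [j.+1 < t] flip the sheet at inner vertices only. *)
have dn : [set (nth z0 p j, b j (+) (0 < j)); (nth z0 p j.+1, b j.+1 (+) (j.+1 < t))]
     \in cycle_edges c.
  have jc : t.*2 - j.+1 < t.*2 by clear -jt t_gt1; lia.
  have := @cycle_edges_nth _ w _ (t.*2 - j.+1) double_cycle_uniq.
  rewrite sc nth_double_cycle // => /(_ jc) /=.
  have -> : (if t.*2 - j.+1 <= t then t.*2 - j.+1 else t.*2 - (t.*2 - j.+1)) = j.+1.
    by clear -jt; case: ifP; lia.
  have -> : (t < t.*2 - j.+1) = (j.+1 < t) by clear -jt; lia.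
  have -> : nth w c ((t.*2 - j.+1).+1 %% t.*2) = (nth z0 p j, b j (+) (0 < j)).
    have -> : (t.*2 - j.+1).+1 = t.*2 - j by clear -jt; lia.
    case: (posnP j) => [->|j0].
      by rewrite subn0 modnn nth_double_cycle ?double_gt0 ?(ltnW t_gt1).
    have jt2 : t.*2 - j < t.*2 by clear -jt j0; lia.
    rewrite modn_small // nth_double_cycle //=.
    have -> : (if t.*2 - j <= t then t.*2 - j else t.*2 - (t.*2 - j)) = j.
      by clear -jt; case: ifP; lia.
    by have -> : t < t.*2 - j by clear -jt; lia.
  by rewrite setUC.
clear sc w.
have [j0|j0] := posnP j; have [tj|tj] := leqP t j.+1; first by clear -t_gt1 j0 tj; lia.
- rewrite h0 // j0; move: up dn; rewrite j0 /= addbF.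
  by rewrite t_gt1 addbT; case: (b 1); case: (d').
- have tE : j.+1 = t by apply/eqP; rewrite eqn_leq jt.
  move: dn up; rewrite ht // -tE ltnn j0 addbT addbF.
  by case: (b j); case: (d).
move: (hj j0 tj) up dn; rewrite j0 tj !addbT.
by case: (b j); case: (b j.+1); case: (d); case: (d').
Qed.

Definition lower_sheet (U : {set V}) : {set V * bool} :=
  [set x | (x.1 \in U) && ~~ x.2].

Definition inner_count (U : {set V}) := \sum_(1 <= j < t) (nth z0 p j \in U).

(** An inner vertex occurs in both copies, exactly one of which is in the lower sheet; an end [i]
    occurs only in copy [b i]. *)
Lemma odd_count_double_cycle (U : {set V}) :
  odd (count (mem (lower_sheet U)) c) =
  ((nth z0 p 0 \in U) && ~~ b 0) (+) ((nth z0 p t \in U) && ~~ b t)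
    (+) odd (inner_count U).
Proof.
pose F i d : nat := (nth z0 p i \in U) && ~~ (b i (+) d).
have -> : count (mem (lower_sheet U)) c =
    \sum_(0 <= j < t.*2) F (if j <= t then j else t.*2 - j) (t < j).
  rewrite count_map -sum1_count big_mkcond /index_iota subn0.
  by apply: eq_bigr => j _; rewrite /F /= inE /=; case: ifP.
rewrite (@big_cat_nat _ _ _ t.+1) //=; last by lia.
rewrite big_nat_recr // big_ltn //=; last lia.
have -> : \sum_(t.+1 <= j < t.*2) F (if j <= t then j else t.*2 - j) (t < j) =
    \sum_(1 <= j < t) F j true.
  rewrite big_nat_rev -[t.+1]add1n big_addn -addnn addnK.
  apply: eq_big_nat => j /andP[j0 jt]; congr F; last lia.
  by rewrite ifF; lia.
have -> : \sum_(1 <= j < t) F (if j <= t then j else t.*2 - j) (t < j) =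
    \sum_(1 <= j < t) F j false.
  by apply: eq_big_nat => j /andP[j0 jt]; congr F; [rewrite ifT|]; lia.
rewrite leqnn ltnn.
have -> : odd (inner_count U) =
    odd (\sum_(1 <= j < t) F j false) (+) odd (\sum_(1 <= j < t) F j true).
  rewrite -oddD -big_split /=; congr odd; apply: eq_big_nat => j _.
  by rewrite /F; case: (_ \in _); case: (b j).
rewrite !oddD /F ltn0 !addbF !oddb.
by rewrite -!addbA; congr (_ (+) _); rewrite addbCA.
Qed.
End OneCycle.

(* For [hi] false and true, the two lifts differ at both ends and at exactly one
   end of each inner edge, so their cycles share no edge. *)
Definition lift_bits (hi e : bool) (i : nat) : bool :=
  if i == 0 then hi else if i == t then hi (+) e else hi && odd i.

Lemma lift_bits_cover z0 (p : seq V) e x y d d' :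
  uniq p -> size p = t.+1 -> adj p x y ->
  exists hi, [set (x, d); (y, d')] \in
    cycle_edges (double_cycle z0 p (lift_bits hi e)).
Proof.
move=> up sp [j]; rewrite sp ltnS => jt /(_ z0) xyE.
have main d1 d2 : exists hi, [set (nth z0 p j, d1); (nth z0 p j.+1, d2)] \in
    cycle_edges (double_cycle z0 p (lift_bits hi e)).
  (* The witness is forced: [hi] is the sheet of the start, [hi (+) e] that of the end, and an inner
     edge changes sheet exactly when [hi] holds. *)
  have [j0|j0] := posnP j; have [tj|tj] := leqP t j.+1; first lia.
  - exists d1; apply: double_cycle_adj => //; try lia.
  - exists (d2 (+) e); apply: double_cycle_adj => //; try lia.
    by rewrite /lift_bits eqxx ifF ?addbK //; lia.
  exists (d1 (+) d2); apply: double_cycle_adj => //; try lia.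
  move=> _ _; rewrite /lift_bits /= !ifF; try lia.
by case: xyE => -[<- <-] //; have [hi] := main d' d; rewrite setUC; exists hi.
Qed.

Definition path_ends_in (U : {set V}) (p : seq V) : Prop :=
  [/\ uniq p, size p = t.+1 & forall z0, nth z0 p 0 \in U /\ nth z0 p t \in U].

(** With both ends in [U], the ends contribute the parity [hi (+) (hi (+) e) = e], so taking for [e]
    the parity of the inner count cancels it. *)
Lemma even_count_lift (U : {set V}) z0 p hi : path_ends_in U p ->
  odd (count (mem (lower_sheet U))
    (double_cycle z0 p (lift_bits hi (odd (inner_count z0 p U))))) = false.
Proof.
case=> up sp /(_ z0)[p0 pt]; rewrite odd_count_double_cycle // p0 pt /=.
rewrite /lift_bits !eqxx (_ : (t == 0) = false); last lia.
by case: hi; case: (odd _).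
Qed.

(** [Q] holds the cycles over the exceptional piece, if any. The count is the number of edges of
    [K_v - I], namely [2tm(tm - 1)], divided by [2t]. *)
Lemma unparalleled_of_paths (m : nat) (U : {set V}) (P : seq (seq V))
    (Q : seq (seq (V * bool))) :
  0 < m -> #|V| = t * m -> odd #|U| ->
  (forall p, p \in P -> path_ends_in U p) ->
  (forall s, s \in Q -> uniq s /\ size s = t.*2) ->
  (forall x y, x != y -> (exists2 p, p \in P & adj p x y) \/
     forall d d', exists2 s, s \in Q & [set (x, d); (y, d')] \in cycle_edges s) ->
  (size P).*2 + size Q = m * (t * m - 1) ->
  (forall s, s \in Q -> odd (count (mem (lower_sheet U)) s) ->
     exists u, [/\ u \notin s, u.1 \notin U, swap_sheet u \in s &
                  forall s', s' \in Q -> u \in s' -> has (mem s) s']) ->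
  exists C : {set {set {set 'I_(2 * t * m)}}}, is_CS (2 * t) C /\ unparalleled C.
Proof.
move=> m0 cardV oddU Pgood Qgood cov cnt Qodd.
have [z0 _] : exists z0, z0 \in U.
  by apply/set0Pn; apply: contraTneq oddU => ->; rewrite cards0.
pose lift p hi := double_cycle z0 p (lift_bits hi (odd (inner_count z0 p U))).
pose L := [seq lift p false | p <- P] ++ [seq lift p true | p <- P] ++ Q.
have inL p hi : p \in P -> lift p hi \in L.
  by move=> pP; rewrite !mem_cat; case: hi; rewrite (map_f (lift^~ _) pP) ?orbT.
have LP s : s \in L -> (exists p hi, p \in P /\ s = lift p hi) \/ s \in Q.
  rewrite !mem_cat => /or3P[/mapP[p pP ->]|/mapP[p pP ->]|]; last by right.
    by left; exists p, false.
  by left; exists p, true.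
have Lgood s : s \in L -> uniq s /\ size s = t.*2.
  case/LP=> [[p [hi [/Pgood[up sp _] ->]]]|/Qgood//].
  by rewrite double_cycle_uniq // size_double_cycle.
apply: (@exists_unparalleled_CS _ swap_sheet _ _ L (lower_sheet U)) => //.
- by case=> x d; rewrite /swap_sheet /= negbK.
- by case=> x d; rewrite /swap_sheet /= xpair_eqE negb_and; case: d; rewrite orbT.
- by rewrite card_prod card_bool cardV; nia.
- lia.
- nia.
- by move=> s /Lgood[].
- by move=> s /Lgood[_ ->]; lia.
- move=> [x d] [y d'] neq1 neq2.
  have xy : x != y.
    apply: contraNneq neq1 => xy; move: neq2.
    by rewrite /swap_sheet !xpair_eqE xy eqxx /=; case: (d); case: (d').
  case: (cov x y xy) => [[p pP pxy]|/(_ d d')[s sQ es]].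
    have [up sp _] := Pgood p pP.
    have [hi] := lift_bits_cover z0 (odd (inner_count z0 p U)) d d' up sp pxy.
    by exists (lift p hi) => //; apply: inL.
  by exists s => //; rewrite !mem_cat sQ !orbT.
- rewrite !size_cat !size_map addnA addnn cnt.
  have -> : 2 * t * m - 2 = 2 * (t * m - 1) by lia.
  by move: (t * m - 1) => k; lia.
- have -> : #|lower_sheet U| = #|U| => //.
  rewrite -(card_imset U (f := fun x => (x, false))); last by move=> x y [].
  apply: eq_card => -[x d]; rewrite !inE /=.
  apply/andP/imsetP => [[xU]|[y yU [-> ->]]] //.
  by case: d => // _; exists x.
move=> s /LP[[p [hi [/Pgood gp ->]]]|sQ]; first by rewrite even_count_lift.
case/(Qodd s sQ)=> -[u du] [/= us uU us' uQ]; exists (u, du) => // s' /LP[|]; last exact: uQ.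
(* The ends of [p] are in [U] and [u] is not, so [u] is an inner vertex; the cycle contains both its
   copies, and the other copy is on [s]. *)
case=> p [hi [/Pgood[up sp /(_ z0)[p0 pt]] ->]] uc.
apply/hasP; exists (u, ~~ du) => //.
have [i ip uE] : exists2 i, i <= t & u = nth z0 p i.
  case/mapP: uc => j; rewrite mem_iota => /= jt [-> _].
  by exists (if j <= t then j else t.*2 - j) => //; clear -jt; case: ifP; lia.
move: uc; rewrite uE /lift !mem_double_cycle // => /orP[->//|_].
rewrite (_ : 0 < i < t) //; apply: contraNT uU; rewrite uE.
have [->//|i0] := posnP i; have [ti|//] := leqP t i.
by have -> : i = t by apply/eqP; rewrite eqn_leq ip.
Qed.

Lemma odd_setC1 (z : V) : ~~ odd #|V| -> odd #|[set~ z]|.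
Proof.
move=> ev; have := cardsC1 z; have : 0 < #|V| by apply/card_gt0P; exists z.
by case: #|V| ev => //= n /negPn on _ ->.
Qed.

(** The two cycles over [p0] contain different copies of its end [z], and both contain the copies of
    the next vertex, which is inner as [t > 1]. The copy of [z] missing from one cycle is thus a
    witness for the parity criterion. *)
Lemma unparalleled_of_paths_endpoint (m : nat) (z : V) (p0 : seq V)
    (P : seq (seq V)) :
  0 < m -> #|V| = t * m -> ~~ odd #|V| ->
  (forall p, p \in P -> path_ends_in [set~ z] p) ->
  uniq p0 -> size p0 = t.+1 -> nth z p0 0 = z ->
  (forall x y, x != y -> exists2 p, p \in p0 :: P & adj p x y) ->
  (size P).+1.*2 = m * (t * m - 1) ->
  exists C : {set {set {set 'I_(2 * t * m)}}}, is_CS (2 * t) C /\ unparalleled C.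
Proof.
move=> m0 cardV ev Pgood up sp pz cov cnt.
pose c hi := double_cycle z p0 (lift_bits hi false).
have memc hi : (nth z p0 1, true) \in c hi by rewrite mem_double_cycle //; lia.
have inQ s : s \in [:: c false; c true] -> exists hi, s = c hi.
  by rewrite !inE => /orP[] /eqP->; eexists.
apply: (unparalleled_of_paths m0 cardV (odd_setC1 z ev) Pgood (Q := [:: c false; c true])).
- by move=> s /inQ[hi ->]; rewrite double_cycle_uniq // size_double_cycle.
- move=> x y /cov[p]; rewrite inE => /orP[/eqP->|pP] pxy; last by left; exists p.
  right=> d d'; have [hi] := lift_bits_cover z false d d' up sp pxy.
  by exists (c hi); rewrite // !inE; case: (hi); rewrite eqxx ?orbT.
- by rewrite -cnt /=; lia.
have memz d hi : ((z, d) \in c hi) = (d == hi).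
  by rewrite -[X in (X, _)]pz mem_double_cycle.
move=> s /inQ[hi ->] _; exists (z, ~~ hi).
rewrite /swap_sheet /= negbK !memz !inE !eqxx; split=> //; first by case: (hi).
by move=> s' /inQ[hi' ->] _; apply/hasP; exists (nth z p0 1, true); apply: memc.
Qed.

(** * Doubling a tripod into three cycles *)

Section Spider.
Variables (r : nat) (c : V).
Hypothesis tE : t = r.*2.

(* A leg is listed from the centre [c] (excluded) to its free end.  Each leg is
   lifted straight in one of its two cycles and alternately in the other. *)
Definition two_legs (X Y : seq V) := rev X ++ c :: Y.
Definition two_legs_bits (i : nat) := if i == t then true else (r < i) && odd (i - r).
Definition two_legs_cycle X Y := double_cycle c (two_legs X Y) two_legs_bits.

Lemma size_two_legs X Y : size X = r -> size Y = r -> size (two_legs X Y) = t.+1.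
Proof. by rewrite size_cat size_rev /= => -> ->; lia. Qed.

Lemma nth_two_legs_l X Y k : size X = r -> k <= r ->
  nth c (two_legs X Y) (r - k) = nth c (c :: X) k.
Proof.
move=> sX kr; rewrite nth_cat size_rev sX; case: k kr => [|k] kr /=.
  by rewrite subn0 ltnn subnn.
by rewrite ifT ?nth_rev ?sX; try lia; congr nth; lia.
Qed.

Lemma nth_two_legs_r X Y k : size X = r ->
  nth c (two_legs X Y) (r + k) = nth c (c :: Y) k.
Proof. by move=> sX; rewrite nth_cat size_rev sX ifF ?addKn //; lia. Qed.

(** [X] is the first leg of one cycle, lifted straight, and the second leg of the other, lifted
    alternately; between them they contain all four lifts of each edge of [X]. *)
Lemma two_legs_cycle_cover X Y Z x y d d' :
  size X = r -> size Y = r -> size Z = r ->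
  uniq (two_legs X Y) -> uniq (two_legs Z X) -> adj (c :: X) x y ->
  [set (x, d); (y, d')] \in cycle_edges (two_legs_cycle X Y) \/
  [set (x, d); (y, d')] \in cycle_edges (two_legs_cycle Z X).
Proof.
move=> sX sY sZ uXY uZX [k]; rewrite [size _]/= sX ltnS => kr /(_ c) xyE.
have main d1 d2 :
    [set (nth c (c :: X) k, d1); (nth c (c :: X) k.+1, d2)] \in
      cycle_edges (two_legs_cycle X Y) \/
    [set (nth c (c :: X) k, d1); (nth c (c :: X) k.+1, d2)] \in
      cycle_edges (two_legs_cycle Z X).
  (* At the free end of the leg the sheet of that end decides which cycle has the edge; elsewhere
     the change of sheet does. *)
  pose par := if k.+1 == r then d2 else d1 (+) d2.
  have [parT|parF] := boolP par; [right|left].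
    rewrite -(nth_two_legs_r X k sZ) -(nth_two_legs_r X k.+1 sZ) addnS.
    apply: double_cycle_adj; rewrite ?size_two_legs //; try lia.
      move=> e; move: parT; rewrite /par ifT; last lia.
      by rewrite /two_legs_bits eqxx.
    move=> k0 kt; move: parT; rewrite /par ifF; last lia.
    move=> ->; rewrite /two_legs_bits !ifF; try lia.
  rewrite setUC -(nth_two_legs_l Y sX (ltnW kr)) -(nth_two_legs_l Y sX kr).
  have -> : r - k = (r - k.+1).+1 by lia.
  apply: double_cycle_adj; rewrite ?size_two_legs //; try lia.
    move=> e; move: parF; rewrite /par ifT; last lia.
    by rewrite /two_legs_bits ifF; [case: (d2); lia | lia].
  move=> k0 kt; move: parF; rewrite /par ifF; last lia.
  rewrite addbC => /negbTE ->; rewrite /two_legs_bits !ifF; lia.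
case: xyE => -[<- <-]; first exact: main.
by rewrite setUC; apply: main.
Qed.

(** The three cycles pairwise meet in the copies of the centre. The two that use leg [C] contain
    only one copy of [z] each, so the other copy is the witness; the third has even intersection
    with the lower sheet. *)
Lemma unparalleled_of_paths_spider (m : nat) (z : V) (A B C : seq V)
    (P : seq (seq V)) :
  0 < m -> #|V| = t * m ->
  (forall p, p \in P -> path_ends_in [set~ z] p) ->
  size A = r -> size B = r -> size C = r -> uniq (c :: A ++ B ++ C) ->
  nth c (c :: C) r = z ->
  (forall x y, x != y ->
     exists2 p, p \in [:: c :: A, c :: B, c :: C & P] & adj p x y) ->
  (size P).*2 + 3 = m * (t * m - 1) ->
  exists D : {set {set {set 'I_(2 * t * m)}}}, is_CS (2 * t) D /\ unparalleled D.
Proof.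
move=> m0 cardV Pgood sA sB sC; rewrite /= !mem_cat !cat_uniq has_cat !negb_or.
case/andP=> /and3P[cA cB cC] /and3P[uA /andP[dAB dAC] /and3P[uB dBC uC]] zE cov cnt.
have uleg X Y : uniq X -> uniq Y -> c \notin X -> c \notin Y -> ~~ has (mem X) Y ->
    uniq (two_legs X Y).
  move=> uX uY cX cY dXY; rewrite cat_uniq rev_uniq uX /= cY uY mem_rev (negPf cX) /= andbT.
  by apply: contra dXY => /hasP[w wY]; rewrite /= mem_rev => wX; apply/hasP; exists w.
have r0 : 0 < r by move: t_gt1; rewrite tE; case: (r).
have uAB := uleg A B uA uB cA cB dAB.
have uBC := uleg B C uB uC cB cC dBC.
have uCA : uniq (two_legs C A) by apply: uleg => //; rewrite has_sym.
pose Q := [:: two_legs_cycle A B; two_legs_cycle B C; two_legs_cycle C A].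
have memc X Y : size X = r -> size Y = r -> uniq (two_legs X Y) ->
    (c, true) \in two_legs_cycle X Y.
  move=> sX sY uXY; have cE : nth c (two_legs X Y) r = c.
    by have := nth_two_legs_l Y sX (leq0n r); rewrite subn0.
  rewrite -[X in (X, _)]cE mem_double_cycle ?size_two_legs // tE; last by rewrite -addnn leq_addr.
  by rewrite r0 -addnn -[X in X < _]addn0 ltn_add2l r0.
have inQ s : s \in Q -> exists X Y, [/\ s = two_legs_cycle X Y, size X = r, size Y = r
    & uniq (two_legs X Y)].
  by rewrite !inE => /or3P[] /eqP->; [exists A, B | exists B, C | exists C, A].
have hasQ s s' : s \in Q -> s' \in Q -> has (mem s) s'.
  move=> /inQ[X [Y [-> sX sY uXY]]] /inQ[X' [Y' [-> sX' sY' uXY']]].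
  by apply/hasP; exists (c, true); apply: memc.
have zC : z \in C.
  by rewrite -zE -(prednK r0) /= mem_nth // sC prednK.
have zc : z != c by apply: contraNneq cC => <-.
apply: (unparalleled_of_paths m0 cardV _ Pgood (Q := Q)).
- by apply: odd_setC1; rewrite cardV tE -mul2n -mulnA oddM.
- by move=> s /inQ[X [Y [-> sX sY uXY]]];
    rewrite double_cycle_uniq ?size_double_cycle ?size_two_legs.
- move=> x y /cov[p]; rewrite !inE => /or4P[/eqP->|/eqP->|/eqP->|pP] pxy;
    last by left; exists p.
  + right=> d d'; case: (two_legs_cycle_cover d d' sA sB sC uAB uCA pxy) => h;
      by eexists; last exact: h; rewrite !inE eqxx ?orbT.
  + right=> d d'; case: (two_legs_cycle_cover d d' sB sC sA uBC uAB pxy) => h;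
      by eexists; last exact: h; rewrite !inE eqxx ?orbT.
  + right=> d d'; case: (two_legs_cycle_cover d d' sC sA sB uCA uBC pxy) => h;
      by eexists; last exact: h; rewrite !inE eqxx ?orbT.
- by rewrite -cnt.
have b0 : two_legs_bits 0 = false.
  by rewrite /two_legs_bits eq_sym -leqn0 leqNgt (ltnW t_gt1).
have bt : two_legs_bits t = true by rewrite /two_legs_bits eqxx.
move=> s sQ; move: (sQ); rewrite !inE => /or3P[] /eqP sE; rewrite sE; last 1 first.
- have memz d : ((z, d) \in two_legs_cycle C A) = (d == false).
    have z0 : nth c (two_legs C A) 0 = z.
      by rewrite -zE -(nth_two_legs_l A sC (leqnn r)) subnn.
    by rewrite -[X in (X, _)]z0 mem_double_cycle ?size_two_legs // b0.
  move=> _; exists (z, true); rewrite /swap_sheet /= !memz !inE eqxx.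
  by split=> // s' s'Q _; apply: hasQ => //; rewrite -sE.
(* This cycle avoids [z]: it meets the lower sheet in one end and once over each of the [t - 1]
   inner vertices, [t] points in all, and [t] is even. *)
- have zAB i : nth c (two_legs A B) i \in [set~ z].
    rewrite !inE; apply/eqP=> iz.
    have : z \in two_legs A B.
      rewrite -iz; have [it|it] := ltnP i (size (two_legs A B)); first exact: mem_nth.
      by move: zc; rewrite -iz nth_default // eqxx.
    rewrite mem_cat mem_rev inE (negPf zc) /= => /orP[zA|zB].
      by case/hasP: dAC; exists z.
    by case/hasP: dBC; exists z.
  rewrite odd_count_double_cycle ?size_two_legs // !zAB b0 bt /=.
  have -> : inner_count c (two_legs A B) [set~ z] = t - 1.
    rewrite /inner_count (eq_bigr (fun=> 1)) => [|i _]; last by rewrite zAB.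
    by rewrite sum_nat_const_nat muln1.
  by rewrite tE -(prednK r0) doubleS subn1 /= odd_double.
have memz d : ((z, d) \in two_legs_cycle B C) = (d == true).
  have zt : nth c (two_legs B C) t = z.
    by rewrite -zE -(nth_two_legs_r C r sB) addnn -tE.
  by rewrite -[X in (X, _)]zt mem_double_cycle ?size_two_legs // bt ltnn andbF.
move=> _; exists (z, false); rewrite /swap_sheet /= !memz !inE eqxx.
by split=> // s' s'Q _; apply: hasQ => //; rewrite -sE.
Qed.
End Spider.
End DoubleCover.

Local Coercion Z.of_nat : nat >-> Z.

(** * Rotational path packings *)

(* Consecutive terms of [0, d, -1, d + 1, -2, ..] differ by [d, d + 1, d + 2, ..]. *)
Definition zigzag (d j : nat) : Z := if odd j then (d + j./2)%Z else (- j./2)%Z.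

Variant zigzag_spec (d j : nat) : Z -> Prop :=
  | ZigzagEven (k : nat) of j = k + k : zigzag_spec d j (- k)
  | ZigzagOdd (k : nat) of j = (k + k).+1 : zigzag_spec d j (d + k).

Lemma zigzagP d j : zigzag_spec d j (zigzag d j).
Proof. by rewrite /zigzag; case: ifP => oj; constructor; lia. Qed.

Lemma adjC (V : finType) (p : seq V) x y : adj p x y -> adj p y x.
Proof. by case=> j jp h; exists j => // z0; case: (h z0); [right | left]. Qed.

Lemma Z_mul_neq_small (t x c : Z) : (0 < c < t)%Z -> c <> (t * x)%Z.
Proof.
move=> ct e; have [x0|x0] : (x <= 0 \/ 1 <= x)%Z by lia.
  by nia.
by nia.
Qed.

Section Cyclic.
Variables (V : finType) (N : nat) (zv : Z -> V).
(** [zv] is reduction modulo [N]; it need not be onto, which leaves room in [V] for a point at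
    infinity. *)
Hypothesis zvE : forall x y, zv x = zv y <-> exists w, (x = y + w * N)%Z.

Lemma zv_inj x y : zv x = zv y -> (Z.abs (x - y) < N)%Z -> x = y.
Proof.
move=> /zvE[w ->] h.
have [h1 h2] : (w * N < N /\ - N < w * N)%Z by lia.
have [w1 w2] : (w < 1 /\ -1 < w)%Z by split; nia.
by have -> : w = 0%Z; lia.
Qed.

Lemma zv_repr a : 0 < N -> exists2 i : nat, i < N & zv a = zv i.
Proof.
move=> N0; have Nz : (0 < N)%Z by lia.
have [b1 b2] := Z.mod_pos_bound a N Nz.
exists (Z.to_nat (a mod N)); first lia.
by apply/zvE; exists (a / N)%Z; rewrite Z2Nat.id // {1}(Z.div_mod a N); lia.
Qed.

(** A sufficient condition for injectivity modulo [N] in plain integer inequalities, within reach of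
    linear arithmetic. *)
Definition spread (t : nat) (f : nat -> Z) : Prop :=
  forall i j, i < j -> j <= t -> f i <> f j /\ (Z.abs (f i - f j) < N)%Z.

Definition zpath t (a : Z) (f : nat -> Z) := mkseq (fun j => zv (a + f j)) t.+1.

Lemma zpath_uniq t a f : spread t f -> uniq (zpath t a f).
Proof.
move=> sf; apply/(mkseq_uniqP _).
suff main i j : i < j -> j <= t -> zv (a + f i) <> zv (a + f j).
  move=> i j; rewrite !inE !ltnS => it jt e.
  by case: (ltngtP i j) => // ij; [case: (main i j) | case: (main j i)].
by move=> ij jt e; have [neq lt] := sf i j ij jt; case: neq; have := zv_inj e; lia.
Qed.

Lemma nth_zpath t a f z0 j : j <= t -> nth z0 (zpath t a f) j = zv (a + f j).
Proof. by move=> jt; rewrite nth_mkseq. Qed.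

Lemma adj_zpath t a f j b c : j < t ->
  zv b = zv (a + f j) -> zv c = zv (a + f j.+1) -> adj (zpath t a f) (zv b) (zv c).
Proof.
by move=> jt -> ->; exists j; rewrite ?size_mkseq // => z0; left; rewrite !nth_zpath // ltnW.
Qed.

Definition covers (P : seq (seq V)) (d : nat) : Prop :=
  forall a, exists2 p, p \in P & adj p (zv a) (zv (a + d)).

(* [q] paths whose edges include all pairs at distance [d] with [D d]; that they
   form a decomposition follows at the end from the total number of paths. *)
Definition packing (t : nat) (U : {set V}) (q : nat) (D : nat -> Prop) : Prop :=
  exists P, [/\ size P = q, forall p, p \in P -> path_ends_in t U p
              & forall d, D d -> covers P d].

Lemma packing0 t U : packing t U 0 (fun=> False).
Proof. by exists [::]. Qed.

Lemma packingU t U q1 q2 D1 D2 : packing t U q1 D1 -> packing t U q2 D2 ->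
  packing t U (q1 + q2) (fun d => D1 d \/ D2 d).
Proof.
move=> [P1 [<- g1 c1]] [P2 [<- g2 c2]]; exists (P1 ++ P2); split.
- by rewrite size_cat.
- by move=> p; rewrite mem_cat => /orP[/g1|/g2].
move=> d [/c1|/c2] cd a; have [p pP ad] := cd a; exists p => //.
  by rewrite mem_cat pP.
by rewrite mem_cat pP orbT.
Qed.

Lemma packing_sub t (U : {set V}) q (D D' : nat -> Prop) :
  (forall d, D' d -> D d) -> packing t U q D -> packing t U q D'.
Proof. by move=> sub [P [sP gP cP]]; exists P; split=> // d /sub/cP. Qed.

Lemma packing_orbit t (U : {set V}) f (D : nat -> Prop) : 0 < N -> (forall a, zv a \in U) ->
  spread t f ->
  (forall d, D d -> exists2 j, j < t & f j.+1 = (f j + d)%Z \/ f j = (f j.+1 + d)%Z) ->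
  packing t U N D.
Proof.
move=> N0 zU sf cD; exists [seq zpath t i f | i : nat <- iota 0 N]; split.
- by rewrite size_map size_iota.
- move=> _ /mapP[i _ ->]; split; rewrite ?size_mkseq ?zpath_uniq // => z0.
  by rewrite !nth_zpath.
move=> d /cD[j jt jd] a.
(* This rotation brings the lower end of the edge of difference [d] to [a]. *)
have [i iN iE] := zv_repr (a - Z.min (f j) (f j.+1)) N0.
exists (zpath t i f); first by apply: (map_f (fun i : nat => zpath t i f)); rewrite mem_iota.
move: iE => /zvE[w wE].
case: jd => jd; [|apply: adjC]; apply: adj_zpath (jt) _ _; apply/zvE; exists w; lia.
Qed.

Lemma packing_zigzag t (U : {set V}) d0 : 0 < N -> (forall a, zv a \in U) ->
  0 < d0 -> d0 + t <= N -> packing t U N (fun d => d0 <= d < d0 + t).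
Proof.
move=> N0 zU d00 dN; apply: (packing_orbit (f := zigzag d0)) => //.
  by move=> i j ij jt; case: zigzagP => k kE; case: zigzagP => l lE; lia.
move=> d dE; exists (d - d0); first by lia.
by case: zigzagP => k kE; case: zigzagP => l lE; lia.
Qed.

Lemma packing_zigzags t (U : {set V}) d0 g : 0 < N -> (forall a, zv a \in U) ->
  0 < d0 -> d0 + g * t <= N -> packing t U (g * N) (fun d => d0 <= d < d0 + g * t).
Proof.
move=> N0 zU d00; elim: g => [|g IH] dN.
  by apply: packing_sub (packing0 _ _); lia.
have h1 : d0 + g * t <= N by lia.
have h2 : 0 < d0 + g * t by lia.
have h3 : d0 + g * t + t <= N by lia.
rewrite mulSnr.
by apply: packing_sub (packingU (IH h1) (packing_zigzag N0 zU h2 h3)) => d; lia.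
Qed.

(** [T] is a closed trail of length [q * t], cut at the times [o + a * t] into [q] paths. Any [t]
    consecutive steps form a path, and no cut falls outside [U]. *)
Lemma packing_trail t (U : {set V}) q (T : nat -> V) o (D : nat -> Prop) : 0 < t ->
  (forall j, T (j + q * t) = T j) ->
  (forall j i i', i < i' -> i' <= t -> T (j + i) <> T (j + i')) ->
  (forall a, T (o + a * t) \in U) -> 0 < q ->
  (forall d a, D d -> exists j, (T j = zv a /\ T j.+1 = zv (a + d)) \/
                                (T j.+1 = zv a /\ T j = zv (a + d))) ->
  packing t U q D.
Proof.
move=> t0 Tper Tinj Tends q0 Tcov.
pose p a := mkseq (fun i => T (o + a * t + i)) t.+1.
exists [seq p a | a <- iota 0 q]; split.
- by rewrite size_map size_iota.
- move=> _ /mapP[a _ ->]; split; rewrite ?size_mkseq //.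
    apply/(mkseq_uniqP _) => i j; rewrite !inE !ltnS => it jt e.
    by case: (ltngtP i j) => // ij; [case: (Tinj (o + a * t) i j) | case: (Tinj (o + a * t) j i)].
  by move=> z0; rewrite !nth_mkseq // addn0 -addnA -mulSnr.
move=> d Dd b; have [j jE] := Tcov d b Dd.
have Tper' k i : T (i + k * (q * t)) = T i.
  by elim: k => [|k IH]; rewrite ?addn0 // mulSnr addnA Tper.
(* The time of the edge counted from the cut [o], modulo the period. Adding [o] periods first keeps
   the subtraction exact in [nat]. *)
pose k := (j + o * (q * t) - o) %% (q * t).
have kE : exists w w', j + w * (q * t) = o + k + w' * (q * t).
  exists o, ((j + o * (q * t) - o) %/ (q * t)); rewrite -addnA [k + _]addnC -divn_eq.
  by rewrite subnKC // -[X in X <= _]muln1; nia.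
have TE i : T (j + i) = T (o + k + i).
  have [w [w' e]] := kE.
  by rewrite -(Tper' w) -(Tper' w' (o + k + i)) addnAC e addnAC.
have kq : k < q * t by rewrite ltn_mod muln_gt0 q0.
exists (p (k %/ t)).
  by apply: map_f; rewrite mem_iota /= add0n ltn_divLR.
have kt : k %% t < t by rewrite ltn_mod.
have nthp i : k %% t + i <= t -> forall z0, nth z0 (p (k %/ t)) (k %% t + i) = T (j + i).
  move=> h z0; rewrite nth_mkseq // TE; congr T.
  by rewrite {3}(divn_eq k t) !addnA.
exists (k %% t); first by rewrite size_mkseq.
move=> z0; rewrite -addn1 nthp ?addn1 // -[k %% t]addn0 nthp ?addn0 1?ltnW // ?addn1.
by case: jE => -[-> ->]; [left | right].
Qed.

(* The closed trail [0, d, -1, d - 1, -2, ..] of length [2N], cut every [t] steps;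
   it visits 0 twice, and as [t > 2] an offset exists for which no cut is at 0. *)
Lemma packing_pair t m (U : {set V}) d : N = t * m -> 2 < t -> 0 < m ->
  (forall a, zv a <> zv 0 -> zv a \in U) -> t <= d.*2 -> d.*2 + t + 1 < N.*2 ->
  packing t U m.*2 (fun e => e = d \/ e = d.+1).
Proof.
move=> NE t2 m0 zU td dN.
pose f j : Z := if odd j then (d - j./2)%Z else (- j./2)%Z.
have fP (j : nat) : exists k : nat,
    j = k + k /\ (f j = - k)%Z \/ j = (k + k).+1 /\ (f j = d - k)%Z.
  by exists j./2; rewrite /f; case: ifP => oj; [right | left]; lia.
(* The trail is at 0 at the times 0 and [2d + 1] modulo [2N], a multiple of [t]. So [o] must avoid 0
   and [2d + 1] modulo [t]. *)
pose o := if t %| d.*2 then 2 else 1.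
apply: (packing_trail (T := fun j => zv (f j)) (o := o)); try lia.
- move=> j; apply/zvE; have [k kE] := fP j; have [l lE] := fP (j + m.*2 * t).
  by exists (-1)%Z; subst N; nia.
(* Two visits to the same vertex are [2d + 1] steps apart modulo [2N]; by [td] and [dN] both gaps
   exceed [t]. *)
- move=> j i i' ii' it e; have [k kE] := fP (j + i); have [l lE] := fP (j + i').
  by move: e; clear -kE lE ii' it td dN zvE => /zv_inj; lia.
- move=> a; apply: zU => /zvE[w wE]; have [k kE] := fP (o + a * t).
  have [[oE td2]|[oE td2]] : (o = 2 /\ t %| d.*2) \/ (o = 1 /\ ~~ (t %| d.*2)).
    by rewrite /o; case: ifP; [left | right].
  + case/dvdnP: td2 => b bE; case: kE => -[k1 k2].
      by apply: (@Z_mul_neq_small t (- 2 * w * m - a) 2); nia.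
    by apply: (@Z_mul_neq_small t (b - 2 * w * m - a) 1); nia.
  case: kE => -[k1 k2].
    by apply: (@Z_mul_neq_small t (- 2 * w * m - a) 1); nia.
  move/negP: td2; apply; apply/dvdnP; exists (Z.to_nat (a + 2 * w * m)).
  by nia.
move=> e a eE.
have N0 : 0 < N by lia.
case: eE => ->.
  have [i iN /zvE[w iE]] := zv_repr (- a) N0; exists (i + i); left.
  have [k kE] := fP (i + i); have [l lE] := fP (i + i).+1.
  by split; apply/zvE; exists w; lia.
have [i iN /zvE[w iE]] := zv_repr (- a - 1) N0; exists (i + i).+1; right.
have [k kE] := fP (i + i).+1; have [l lE] := fP (i + i).+2.
by split; apply/zvE; exists w; lia.
Qed.

Lemma packing_pairs t m (U : {set V}) d g : N = t * m -> 2 < t -> 0 < m ->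
  (forall a, zv a <> zv 0 -> zv a \in U) -> t <= d.*2 -> (d + g.*2).*2 + t <= N.*2 + 2 ->
  packing t U (g * m.*2) (fun e => d <= e < d + g.*2).
Proof.
move=> NE t2 m0 zU td; elim: g => [|g IH] dN.
  by apply: packing_sub (packing0 _ _); lia.
have h1 : (d + g.*2).*2 + t <= N.*2 + 2 by lia.
have h2 : t <= (d + g.*2).*2 by lia.
have h3 : (d + g.*2).*2 + t + 1 < N.*2 by lia.
rewrite mulSnr.
by apply: packing_sub (packingU (IH h1) (packing_pair NE t2 m0 zU h2 h3)) => e; lia.
Qed.

(** The closed trail 0, 1, 2, .. of length [t * m], cut at times congruent to 1 modulo [t], is never
    cut at 0. *)
Lemma packing_single t m (U : {set V}) : N = t * m -> 1 < t -> 1 < m ->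
  (forall a, zv a <> zv 0 -> zv a \in U) -> packing t U m (fun e => e = 1).
Proof.
move=> NE t2 m1 zU; apply: (packing_trail (T := fun j : nat => zv j) (o := 1)); try lia.
- by move=> j; apply/zvE; exists 1%Z; subst N; lia.
- by move=> j i i' ii' it /zv_inj; nia.
- by move=> a; apply: zU => /zvE[w wE]; apply: (@Z_mul_neq_small t (w * m - a) 1); nia.
move=> _ a ->; have N0 : 0 < N by nia.
have [i iN /zvE[w iE]] := zv_repr a N0; exists i; left.
by split; apply/zvE; exists (-w)%Z; lia.
Qed.

End Cyclic.

Fact Zord_subproof n (n0 : 0 < n) (x : Z) : Z.to_nat (x mod n) < n.
Proof. by have := Z.mod_pos_bound x n; lia. Qed.

Definition Zord n (n0 : 0 < n) (x : Z) : 'I_n := Ordinal (Zord_subproof n0 x).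

Section Zord.
Variables (n : nat) (n0 : 0 < n).
Local Notation zv := (Zord n0).

Lemma ZordE x y : zv x = zv y <-> exists w, (x = y + w * n)%Z.
Proof.
have nz : (n : Z) <> 0%Z by lia.
split=> [[e]|[w ->]]; last by apply: val_inj; rewrite /= Z_mod_plus_full.
have xp := Z.mod_pos_bound x n; have yp := Z.mod_pos_bound y n.
have {}e : (x mod n = y mod n)%Z by lia.
exists (x / n - y / n)%Z; have := Z.div_mod x n nz; have := Z.div_mod y n nz; nia.
Qed.

Lemma Zord_nat (i : 'I_n) : zv i = i.
Proof. by apply: val_inj; rewrite /= Z.mod_small; have := ltn_ord i; lia. Qed.

Lemma adj_of_covers (Q : 'I_n -> 'I_n -> Prop) :
  (forall x y, Q x y -> Q y x) ->
  (forall d, 0 < d -> d.*2 <= n -> forall a, Q (zv a) (zv (a + d))) ->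
  forall x y, x != y -> Q x y.
Proof.
move=> Qsym Qd.
have main (x y : 'I_n) : x < y -> Q x y.
  move=> xy; have yn := ltn_ord y.
  have [d2|d2] := leqP (y - x).*2 n.
    have := Qd _ _ d2 (nat_of_ord x); rewrite Zord_nat.
    have -> : (nat_of_ord x + (y - x)%nat)%Z = nat_of_ord y by lia.
    by rewrite Zord_nat; apply; lia.
  have := Qd (n - (y - x)) _ _ (nat_of_ord y); rewrite Zord_nat.
  have -> : zv (nat_of_ord y + (n - (y - x))%nat) = x.
    by rewrite -[RHS]Zord_nat; apply/ZordE; exists 1%Z; lia.
  by move=> h; apply: Qsym; apply: h; lia.
move=> x y; rewrite neq_ltn => /orP[/main//|/main/Qsym//].
Qed.
End Zord.

(** * Odd [t] *)

(** With [n = 2h + 1] and [h = t + e + 2g], the differences 1 to [h] are split into at most one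
    single, one zigzag of [t], and [g] pairs. The pairs come last because [packing_pairs] needs
    differences of at least [t/2]. *)
Lemma unparalleled_odd_odd t m : odd t -> odd m -> 1 < t -> 1 < m ->
  exists C : {set {set {set 'I_(2 * t * m)}}}, is_CS (2 * t) C /\ unparalleled C.
Proof.
move=> ot om t1 m1; pose n := t * m; have n0 : 0 < n by rewrite muln_gt0; lia.
have nE := @ZordE n n0; pose zv := Zord n0.
have t3 : 2 < t by clear -ot t1; lia.
have m3 : 2 < m by clear -om m1; lia.
have tn : 3 * t <= n by rewrite mulnC leq_mul2l m3 orbT.
have on : odd n by rewrite oddM ot.
pose h := n./2; have hE : n = h.*2.+1 by clear -on; rewrite /h; lia.
pose e : nat := odd (h - t); pose g := (h - t)./2.
have hgE : h = t + e + g.*2 by clear -hE tn; rewrite /e /g; lia.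
have e1 : e <= 1 by clear; rewrite /e; lia.
have zT a : zv a \in [set: 'I_n] by rewrite inE.
have [P [sP gP cP]] : @packing _ zv t [set: 'I_n] (e * m + n + g * m.*2)
   (fun d => 0 < d <= h).
  have pz : packing zv t [set: 'I_n] n (fun d => e.+1 <= d < e.+1 + t).
    by apply: (packing_zigzag nE) => //; lia.
  have pp : packing zv t [set: 'I_n] (g * m.*2) (fun d => e.+1 + t <= d < e.+1 + t + g.*2).
    by apply: (packing_pairs nE) => //; clear -hE tn hgE e1 m1; lia.
  have ps : packing zv t [set: 'I_n] (e * m) (fun d => 0 < d <= e).
    case: (posnP e) => [->|e0].
      by apply: packing_sub (packing0 zv t _); lia.
    have -> : e = 1 by clear -e0 e1; lia.
    by rewrite mul1n; apply: packing_sub (packing_single nE _ _ _ _) => //; lia.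
  apply: packing_sub (packingU (packingU ps pz) pp) => d; clear -hgE; lia.
apply: (@unparalleled_of_paths _ _ t1 m [set: 'I_n] P [::]) => //.
- by rewrite ltnW.
- by rewrite card_ord.
- by rewrite cardsT card_ord.
- move=> x y xy; left; move: x y xy.
  apply: (@adj_of_covers _ n0 (fun x y => exists2 p, p \in P & adj p x y)).
    by move=> x y [p pP ad]; exists p => //; apply: adjC.
  by move=> d d0 dn a; apply: (cP d); clear -d0 dn hE; lia.
- have -> : t * m - 1 = (t + e + g.*2).*2 by rewrite -hgE; clear -hE; rewrite -/n; lia.
  by rewrite sP addn0 /n; clear; lia.
Qed.

Lemma zigzag0 d : zigzag d 0 = 0%Z.
Proof. by []. Qed.

Lemma zigzag_diff d k : 0 < d ->
  (zigzag d k.+1 = zigzag d k + (d + k)%nat \/ zigzag d k = zigzag d k.+1 + (d + k)%nat)%Z.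
Proof. by move=> d0; case: zigzagP => i iE; case: zigzagP => j jE; lia. Qed.

Lemma zigzag_spread d i j : 0 < d -> i < j ->
  zigzag d i <> zigzag d j /\ (Z.abs (zigzag d i - zigzag d j) <= (d + j.-1)%nat)%Z.
Proof. by move=> d0; case: zigzagP => k kE; case: zigzagP => l lE; lia. Qed.

(* Two zigzags of [r] edges joined at their starting points by the diameter [h]. *)
Definition diameter_path (h r d j : nat) : Z :=
  ((if (j <= r)%nat then zigzag d (r - j) else h + zigzag d (j - r.+1)) - zigzag d r)%Z.

Lemma diameter_path_spread h r d : 0 < d -> d + r <= h ->
  spread h.*2 r.*2.+1 (diameter_path h r d).
Proof.
move=> d0 dr i j ij jr; rewrite /diameter_path.
have sp k l : k <= r -> l <= r -> (Z.abs (zigzag d k - zigzag d l) < h)%Z.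
  move=> kr lr; case: (ltngtP k l) => [kl|kl|->]; last by lia.
    by have [_] := zigzag_spread d0 kl; lia.
  by have [_] := zigzag_spread d0 kl; lia.
have [jr'|jr'] := leqP j r.
  rewrite ifT; last lia.
  have ij' : r - j < r - i by lia.
  have := zigzag_spread d0 ij'.
  have := sp (r - i) (r - j) (leq_subr _ _) (leq_subr _ _); lia.
have [ir|ir] := leqP i r.
  have k2 : j - r.+1 <= r by lia.
  have := sp (r - i) _ (leq_subr _ _) k2; lia.
have ij' : i - r.+1 < j - r.+1 by lia.
have := zigzag_spread d0 ij'.
have k1 : i - r.+1 <= r by lia.
have k2 : j - r.+1 <= r by lia.
have := sp _ _ k1 k2; lia.
Qed.

(** Here [n = 2h] and [t = 2r + 1]. The diameter path contains [h] once and each of [r] further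
    differences twice, so its rotations by 0 to [h - 1] suffice. Rotation [i] joins [i] to [i + h],
    so only rotation 0 has the end 0; it serves as the exceptional path. *)
Lemma unparalleled_odd_even t m : odd t -> ~~ odd m -> 1 < t -> 1 < m ->
  exists C : {set {set {set 'I_(2 * t * m)}}}, is_CS (2 * t) C /\ unparalleled C.
Proof.
move=> ot om t1 m1; pose n := t * m; have n0 : 0 < n by rewrite muln_gt0; lia.
have nE := @ZordE n n0; pose zv := Zord n0.
have t3 : 2 < t by clear -ot t1; lia.
have tn : 2 * t <= n by rewrite mulnC leq_mul2l m1 orbT.
have en : ~~ odd n by rewrite oddM negb_and om orbT.
pose h := n./2; have hE : n = h.*2 by clear -en; rewrite /h; lia.
pose r := t./2; have rE : t = r.*2.+1 by clear -ot; rewrite /r; lia.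
pose e : nat := odd (h - r.+1); pose g := (h - r.+1)./2.
have hgE : h = r.+1 + e + g.*2 by clear -hE tn rE; rewrite /e /g; lia.
have e1 : e <= 1 by clear; rewrite /e; lia.
pose U := [set~ zv 0].
have zU a : zv a <> zv 0 -> zv a \in U by move=> neq; rewrite !inE; apply/eqP.
have [P [sP gP cP]] : @packing _ zv t U (e * m + g * m.*2)
   (fun d => 0 < d <= e \/ r.+1 + e <= d < h).
  have pp : packing zv t U (g * m.*2) (fun d => r.+1 + e <= d < r.+1 + e + g.*2).
    by apply: (packing_pairs nE) => //; clear -hE tn hgE e1 m1 rE; lia.
  have ps : packing zv t U (e * m) (fun d => 0 < d <= e).
    case: (posnP e) => [->|e0].
      by apply: packing_sub (packing0 zv t _); lia.
    have -> : e = 1 by clear -e0 e1; lia.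
    by rewrite mul1n; apply: packing_sub (packing_single nE _ _ _ _) => //; lia.
  by apply: packing_sub (packingU ps pp) => d; clear -hgE; lia.
pose c := e.+1; pose f := diameter_path h r c.
have fs : spread n t f.
  by rewrite hE rE; apply: diameter_path_spread => //; rewrite /c; clear -hgE hE rE tn e1; lia.
pose p (i : nat) := zpath zv t i f.
have p0 i z0 : nth z0 (p i) 0 = zv i.
  rewrite (nth_zpath zv i f z0 (leq0n t)); congr zv.
  by rewrite /f /diameter_path leq0n subn0; lia.
have pt i z0 : nth z0 (p i) t = zv (i + h)%nat.
  rewrite (nth_zpath zv i f z0 (leqnn t)); congr zv.
  by rewrite /f /diameter_path ifF ?rE -addnn -addnS ?addnK; lia.
have sp i : size (p i) = t.+1 by rewrite size_mkseq.
have up i : uniq (p i) by apply: (zpath_uniq nE).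
apply: (@unparalleled_of_paths_endpoint _ _ t1 m (zv 0) (p 0)
   ([seq p i | i <- iota 1 h.-1] ++ P)) => //.
- by rewrite ltnW.
- by rewrite card_ord.
- by rewrite card_ord.
- move=> q; rewrite mem_cat => /orP[/mapP[i]|/gP//].
  rewrite mem_iota => ih ->; split=> // z0; rewrite p0 pt.
  by split; apply: zU => /(zv_inj nE); clear -ih hE; lia.
- have inP i : i < h -> p i \in p 0 :: [seq p i | i <- iota 1 h.-1] ++ P.
    case: (posnP i) => [-> _|i0 ih]; first by rewrite inE eqxx.
    by rewrite inE mem_cat map_f ?orbT // mem_iota; clear -i0 ih; lia.
  apply: (@adj_of_covers _ n0 (fun x y => exists2 q, q \in _ :: _ & adj q x y)).
    by move=> x y [q qP ad]; exists q => //; apply: adjC.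
  move=> d d0 dn a.
  have [cd|cd] := boolP ((0 < d <= e) || (r.+1 + e <= d < h)).
    have [|q qP ad] := cP d _ a; first by case/orP: cd; [left | right].
    by exists q; rewrite // inE mem_cat qP !orbT.
  have [dh|dh] := eqVneq d h.
    have [i iN /nE[w iE]] := zv_repr nE (a + zigzag c r) n0.
    have [ih|ih] := ltnP i h.
      exists (p i); first exact: inP.
      apply: (@adj_zpath _ zv t _ f r); rewrite ?rE; try (clear; lia).
        by apply/nE; exists w; rewrite /f /diameter_path leqnn subnn zigzag0; lia.
      by apply/nE; exists w; rewrite /f /diameter_path ltnn subnn zigzag0; lia.
    exists (p (i - h)); first by apply: inP; clear -iN ih hE; lia.
    apply: adjC; apply: (@adj_zpath _ zv t _ f r); rewrite ?rE; try (clear; lia).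
      by apply/nE; exists (w + 1)%Z; rewrite /f /diameter_path leqnn subnn zigzag0; lia.
    by apply/nE; exists w; rewrite /f /diameter_path ltnn subnn zigzag0; lia.
  (* The second zigzag is the first one rotated by [h]: an edge that needs a rotation [i >= h] is
     found in the second zigzag of rotation [i - h]. *)
  pose k := d - c; have kr : k < r by rewrite /k /c; clear -cd d0 dn hE dh e1; lia.
  pose lo := Z.min (zigzag c k) (zigzag c k.+1).
  have [i iN /nE[w iE]] := zv_repr nE (a - lo + zigzag c r) n0.
  have dE : d = c + k by rewrite /k /c; clear -cd d0 e1; lia.
  have zd := @zigzag_diff c k isT.
  have [ih|ih] := ltnP i h.
    exists (p i); first exact: inP.
    have e1' : (r - k.+1).+1 = r - k by clear -kr; lia.
    have f1 : f (r - k.+1) = (zigzag c k.+1 - zigzag c r)%Z.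
      by rewrite /f /diameter_path leq_subr subKn.
    have f2 : f (r - k) = (zigzag c k - zigzag c r)%Z.
      by rewrite /f /diameter_path leq_subr subKn // ltnW.
    case: zd => zd; [apply: adjC|]; apply: (@adj_zpath _ zv t _ f (r - k.+1));
      rewrite ?e1'; try (clear -rE kr; lia); apply/nE; exists w;
      rewrite ?f1 ?f2; clear -iE dE zd; lia.
  exists (p (i - h)); first by apply: inP; clear -iN ih hE; lia.
  have f1 l : f (r.+1 + l) = (h + zigzag c l - zigzag c r)%Z.
    by rewrite /f /diameter_path ifF ?addKn //; clear; lia.
  case: zd => zd; [|apply: adjC]; apply: (@adj_zpath _ zv t _ f (r.+1 + k));
    rewrite -?addnS; try (clear -rE kr; lia); apply/nE; exists w;
    rewrite ?f1; clear -iE dE zd ih; lia.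
have h0 : 0 < h by clear -hgE; lia.
rewrite size_cat size_map size_iota sP -addSn (prednK h0).
have -> : t * m - 1 = t + (e + g.*2).*2 by clear -hE hgE rE; rewrite -/n; lia.
by rewrite doubleD -hE /n; clear; lia.
Qed.

(** * Even [t] *)

Fixpoint alternating_sum (delta : nat -> nat) (j : nat) : Z :=
  if j is i.+1 then
    (alternating_sum delta i + (if odd i then - delta i else delta i))%Z
  else 0%Z.

(** As for Leibniz series: with decreasing steps, all later partial sums stay on one side of the
    [i]-th, at distance between 1 and [delta i]. *)
Lemma alternating_sum_nested delta l i j :
  (forall k, k.+1 < l -> delta k.+1 < delta k) -> (forall k, k < l -> 0 < delta k) ->
  i < j -> j <= l ->
  (1 <= (if odd i then alternating_sum delta i - alternating_sum delta j
         else alternating_sum delta j - alternating_sum delta i) <= delta i)%Z.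
Proof.
move=> decr pos ij jl.
elim: {i}(j - i) {-2}i (erefl (j - i)) ij => [i|k IH i kE ij]; first lia.
have iE : alternating_sum delta i.+1 =
  (alternating_sum delta i + (if odd i then - delta i else delta i))%Z by [].
have di := pos i; have [ji|ji] := eqVneq j i.+1.
  by rewrite ji iE; case: (odd i); lia.
have := IH i.+1 _ _; rewrite iE /=; have := decr i.
by case: (odd i) => /=; lia.
Qed.

(** * Paths in [Z_(2h+1)] with a point at infinity *)

Section Infinity.
Variables (r m : nat).
Hypotheses (r0 : 0 < r) (m1 : 1 < m).

Let t := r.*2.
Let h := (r * m).-1.
Let N := h.*2.+1.
Let V : finType := option 'I_N.
Let zv (x : Z) : V := Some (Zord (ltn0Sn h.*2) x).

Lemma option_zvE x y : zv x = zv y <-> exists w, (x = y + w * N)%Z.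
Proof.
split=> [e|e]; last by congr Some; apply/ZordE.
by apply/ZordE; case: e => e; apply: val_inj.
Qed.

Lemma succ_h : h.+1 = r * m.
Proof. by rewrite prednK // muln_gt0 r0 ltnW. Qed.

Lemma r_le_h : r.*2 <= h.+1.
Proof. by rewrite succ_h -muln2 leq_mul2l m1 orbT. Qed.

Lemma card_infinity : #|V| = t * m.
Proof. by rewrite card_option card_ord /N /t -doubleS succ_h doubleMl. Qed.

Lemma zv_in a : zv a \in [set~ None].
Proof. by rewrite !inE. Qed.

Section Cover.
Variable L : seq (seq V).
Let Q x y := exists2 p, p \in L & adj p x y.

Lemma cover_sym x y : Q x y -> Q y x.
Proof. by case=> p pL ad; exists p => //; apply: adjC. Qed.

Lemma cover_infinity :
  (forall d, 0 < d -> d <= h -> forall a, Q (zv a) (zv (a + d))) ->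
  (forall a, Q (zv a) None) -> forall x y, x != y -> Q x y.
Proof.
move=> Qd Qn; have nQ i : Q (Some i) None.
  by have := Qn (nat_of_ord i); rewrite /zv Zord_nat.
case=> [x|] [y|] // xy; last by apply: cover_sym.
apply: (@adj_of_covers N (ltn0Sn h.*2) (fun x y => Q (Some x) (Some y))) xy.
  by move=> u v; apply: cover_sym.
by move=> d d0 dn a; apply: (Qd d d0); move: dn; rewrite /N; clear; lia.
Qed.

Lemma cover_shift (u v : Z) (d : nat) :
  (forall i, i < N -> Q (zv (i + u)) (zv (i + v))) ->
  (v = u + d \/ u = v + d)%Z -> forall a, Q (zv a) (zv (a + d)).
Proof.
move=> Qi uv a; have [i iN /option_zvE[w iE]] := zv_repr option_zvE (a - Z.min u v) (ltn0Sn h.*2).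
have := Qi i iN; case: uv => uv.
  have -> : zv (i + u) = zv a by apply/option_zvE; exists (-w)%Z; lia.
  by have -> : zv (i + v) = zv (a + d) by apply/option_zvE; exists (-w)%Z; lia.
move/cover_sym; have -> : zv (i + v) = zv a by apply/option_zvE; exists (-w)%Z; lia.
by have -> : zv (i + u) = zv (a + d) by apply/option_zvE; exists (-w)%Z; lia.
Qed.
End Cover.

Section Arms.
Variable D : nat -> Z.
Hypothesis Dspread : forall i j, i < j -> j < r -> D i <> D j /\ (Z.abs (D i - D j) < h)%Z.

(* The rotations of [D] by [1 .. 2h] come in pairs joined through infinity; the
   rotation by 0 remains, as a leg of [t/2] edges ending at infinity. *)
Definition infinity_path (i : nat) : seq V :=
  mkseq (fun j => if j < r then zv (i + D j) else
                  if j == r then None else zv (i + h + D (t - j))) t.+1.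

Definition infinity_paths := [seq infinity_path i | i <- iota 1 h].

Lemma infinity_paths_ends p : p \in infinity_paths -> path_ends_in t [set~ None] p.
Proof.
case/mapP=> i _ ->; split.
- apply/(mkseq_uniqP _).
  suff main j k : j < k -> k <= t ->
      (if j < r then zv (i + D j) else if j == r then None else zv (i + h + D (t - j))) <>
      (if k < r then zv (i + D k) else if k == r then None else zv (i + h + D (t - k))).
    move=> j k; rewrite !inE !ltnS => jt kt e.
    by case: (ltngtP j k) => // jk; [case: (main j k) | case: (main k j)].
  move=> jk kt; have [kr|kr|kE] := ltngtP k r.
  + rewrite (ltn_trans jk kr) => /(zv_inj option_zvE).
    by have := Dspread jk kr; rewrite /N; clear; lia.
  (* Points on different arms differ by [h] plus a difference of values of [D], which lies strictly
     between 0 and [2h]. *)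
  + have lt1 : t - k < r by clear -kr r0; rewrite /t; lia.
    have [jr|jr|//] := ltngtP j r => /(zv_inj option_zvE).
      rewrite /N; have [e|e|e] := ltngtP j (t - k).
      * by have := Dspread e lt1; clear; lia.
      * by have := Dspread e jr; clear; lia.
      * by rewrite e; have := r_le_h; clear -r0; lia.
    have lt2 : t - k < t - j by clear -jk kt; lia.
    have lt3 : t - j < r by clear -jr r0; rewrite /t; lia.
    by have := Dspread lt2 lt3; rewrite /N; clear; lia.
  by rewrite ifT; [|clear -kE jk; lia].
- by rewrite size_mkseq.
move=> z0; rewrite !nth_mkseq //.
by rewrite r0 /t ifF ?ifF; [rewrite !zv_in | clear -r0; lia | clear; lia].
Qed.

Lemma infinity_paths_arm i k : 0 < i -> i < N -> k.+1 < r ->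
  exists2 p, p \in infinity_paths & adj p (zv (i + D k)) (zv (i + D k.+1)).
Proof.
move=> i0 iN kr; have kr' := ltnW kr; have [ih|ih] := leqP i h.
  exists (infinity_path i); first by rewrite map_f // mem_iota i0.
  exists k; first by rewrite size_mkseq /t; clear -kr; lia.
  by move=> z0; left; rewrite !nth_mkseq ?kr ?kr' // /t; clear -kr; lia.
exists (infinity_path (i - h)).
  by rewrite map_f // mem_iota; clear -ih iN; rewrite /N in iN; lia.
exists (t - k.+1); first by rewrite size_mkseq /t; clear -kr; lia.
have iE : ((i - h)%nat + h)%Z = i by clear -ih; lia.
move=> z0; right; rewrite !nth_mkseq; try by clear -kr r0; rewrite /t; lia.
rewrite !ifF; try by clear -kr r0; rewrite /t; lia.
rewrite iE; split; congr (zv (_ + D _)); clear -kr; rewrite /t; lia.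
Qed.

Lemma infinity_paths_center i : 0 < i -> i < N ->
  exists2 p, p \in infinity_paths & adj p (zv (i + D r.-1)) None.
Proof.
move=> i0 iN; have [ih|ih] := leqP i h.
  exists (infinity_path i); first by rewrite map_f // mem_iota i0.
  exists r.-1; first by rewrite size_mkseq /t; clear -r0; lia.
  move=> z0; left; rewrite !nth_mkseq; try by clear -r0; rewrite /t; lia.
  by rewrite ifT ?prednK // ltnn eqxx.
exists (infinity_path (i - h)).
  by rewrite map_f // mem_iota; clear -ih iN; rewrite /N in iN; lia.
exists r; first by rewrite size_mkseq /t; clear -r0; lia.
have iE : ((i - h)%nat + h)%Z = i by clear -ih; lia.
move=> z0; right; rewrite !nth_mkseq; try by clear -r0; rewrite /t; lia.
rewrite ltnn eqxx !ifF; try by clear; lia.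
rewrite iE; split=> //; congr (zv (_ + D _)); clear -r0; rewrite /t; lia.
Qed.
End Arms.

(** * Even [m]: a walk joined to its own translate *)

Section Doubling.
Variables (D X : nat -> Z).
Hypotheses (D0 : D 0 = 0%Z) (X0 : X 0 = 0%Z).

(* The walk [X] followed by its translate starting at its end [X r].  As [X r] is
   invertible mod [N], the rotations of [X] by [j * X r] for [0 < j < N] are joined
   two by two, and the one for [j = 0] is joined to the leg of infinity. *)
Definition doubled (j : nat) : Z := if (j <= r)%nat then X j else (X r + X (j - r)%nat)%Z.

Definition leg_path : seq V :=
  mkseq (fun j => if j == 0 then None else
                  if j <= r then zv (D (r - j)) else zv (X (j - r))) t.+1.

Lemma nth_leg_pathD z0 j : 0 < j -> j <= r -> nth z0 leg_path j = zv (D (r - j)).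
Proof.
move=> j0 jr; rewrite nth_mkseq; last by clear -jr; rewrite /t; lia.
by rewrite jr eqn0Ngt j0.
Qed.

Lemma nth_leg_pathX z0 j : j <= r -> nth z0 leg_path (r + j) = zv (X j).
Proof.
move=> jr; have [->|j0] := posnP j.
  by rewrite addn0 nth_leg_pathD // subnn D0 X0.
rewrite nth_mkseq; last by clear -jr; rewrite /t; lia.
rewrite addn_eq0 eqn0Ngt r0 -[X in _ <= X]addn0 leq_add2l leqn0 eqn0Ngt j0.
by rewrite addKn.
Qed.

Hypothesis Dspread : forall i j, i < j -> j < r -> D i <> D j /\ (Z.abs (D i - D j) < h)%Z.
Hypothesis XXspread : spread N t doubled.
Hypothesis DXspread : forall j k, 0 < j -> j <= r -> k < r ->
  X j <> D k /\ (Z.abs (X j - D k) < N)%Z.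

Lemma leg_path_uniq : uniq leg_path.
Proof.
apply/(mkseq_uniqP _).
suff main j k : j < k -> k <= t ->
    (if j == 0 then None else if j <= r then zv (D (r - j)) else zv (X (j - r))) <>
    (if k == 0 then None else if k <= r then zv (D (r - k)) else zv (X (k - r))).
  move=> j k; rewrite !inE !ltnS => jt kt e.
  by case: (ltngtP j k) => // jk; [case: (main j k) | case: (main k j)].
move=> jk kt; rewrite (_ : (k == 0) = false); last by clear -jk; lia.
have [_|j0] := eqVneq j 0; first by case: ifP.
have [jr|jr] := leqP j r; have [kr|kr] := leqP k r; try by clear -jk jr kr; lia.
- have lt1 : r - k < r - j by clear -jk kr; lia.
  have lt2 : r - j < r by clear -j0 r0; lia.
  move=> /(zv_inj option_zvE); have := Dspread lt1 lt2.
  by rewrite /N; clear; lia.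
- have lt1 : 0 < k - r by clear -kr; lia.
  have lt2 : k - r <= r by move: kt; clear; rewrite /t; lia.
  have lt3 : r - j < r by clear -j0 r0; lia.
  move=> /(zv_inj option_zvE); have := DXspread lt1 lt2 lt3.
  by clear; lia.
have lt1 : j - r < k - r by clear -jk jr; lia.
have lt2 : k - r <= t by move: kt; clear; lia.
have lt3 : k - r <= r by move: kt; clear; rewrite /t; lia.
move=> /(zv_inj option_zvE); have := XXspread lt1 lt2.
rewrite /doubled lt3 (ltnW (leq_trans lt1 lt3)).
by clear; lia.
Qed.

(** The [r - 1] steps of [D] and the [r] steps of [X] account for the differences below [t]; the
    rest, [t] to [h], form [m/2 - 1] zigzag blocks of length [t]. [leg_path] is the one path that
    ends at infinity. *)
Lemma unparalleled_doubling : ~~ odd m ->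
  (exists w k, X r * w = 1 + k * N)%Z ->
  (forall d, 0 < d -> d < t ->
     (exists2 k : nat, (k.+1 < r)%nat & D k.+1 = D k + d \/ D k = D k.+1 + d)%Z \/
     (exists2 k : nat, (k < r)%nat & X k.+1 = X k + d \/ X k = X k.+1 + d)%Z) ->
  exists C : {set {set {set 'I_(2 * t * m)}}}, is_CS (2 * t) C /\ unparalleled C.
Proof.
move=> em [w [b wE]] Dcov.
have t1 : 1 < t by clear -r0; rewrite /t; lia.
pose g := m./2.-1; have gE : g.+1.*2 = m by clear -em m1; rewrite /g; lia.
have gtE : t + g * t = h.+1 by rewrite -mulSn succ_h -gE /t; clear; lia.
have [||||G [sG gG cG]] := @packing_zigzags V N zv option_zvE t [set~ None] t g.
- by [].
- exact: zv_in.
- by clear -t1; lia.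
- by rewrite gtE /N; clear; lia.
pose c := X r; pose Y (k : nat) := zpath zv t ((k + k).+1 * c) doubled.
pose L := leg_path :: infinity_paths D ++ [seq Y k | k <- iota 0 h] ++ G.
apply: (@unparalleled_of_paths_endpoint V t t1 m None leg_path
  (infinity_paths D ++ [seq Y k | k <- iota 0 h] ++ G) (ltnW m1) card_infinity) => //.
- by rewrite card_infinity oddM negb_and em orbT.
- move=> p; rewrite 2!mem_cat => /or3P[|/mapP[k _ ->]|/gG//].
    exact: infinity_paths_ends.
  split; rewrite ?size_mkseq //; first exact: (zpath_uniq option_zvE).
  by move=> z0; rewrite !nth_mkseq ?zv_in.
- exact: leg_path_uniq.
- by rewrite size_mkseq.
- rewrite -/L; have Linf p : p \in infinity_paths D -> p \in L.
    by move=> pD; rewrite inE mem_cat pD orbT.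
  have LY k : k < h -> Y k \in L.
    by move=> kh; rewrite inE 2!mem_cat map_f ?orbT // mem_iota.
  have shiftD k (d : nat) : k.+1 < r -> (D k.+1 = D k + d \/ D k = D k.+1 + d)%Z ->
      forall a, exists2 p, p \in L & adj p (zv a) (zv (a + d)).
    move=> kr kd a; apply: (@cover_shift L (D k) (D k.+1) d _ kd) => i iN.
    have [->|i0] := posnP i; last first.
      by have [p pD ad] := infinity_paths_arm D i0 iN kr; exists p => //; apply: Linf.
    exists leg_path; first by rewrite inE eqxx.
    exists (r - k.+1); first by rewrite size_mkseq /t; clear -kr; lia.
    move=> z0; right; rewrite !nth_leg_pathD; try by clear -kr; lia.
    have -> : r - (r - k.+1) = k.+1 by clear -kr; lia.
    by have -> : r - (r - k.+1).+1 = k by clear -kr; lia.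
  have shiftX k (d : nat) : k < r -> (X k.+1 = X k + d \/ X k = X k.+1 + d)%Z ->
      forall a, exists2 p, p \in L & adj p (zv a) (zv (a + d)).
    move=> kr kd a; apply: (@cover_shift L (X k) (X k.+1) d _ kd) => i iN.
    (* As [w] inverts [X r], the rotation by [i] is the rotation by [j * X r]. It is in [leg_path]
       for [j = 0], in a first half for odd [j], and in a second half for positive even [j]. *)
    have [j jN /option_zvE[q jE]] := zv_repr option_zvE (i * w) (ltn0Sn h.*2).
    have iE : forall x, zv (i + x) = zv (j * c + x).
      move=> x; apply/option_zvE; exists (q * c - i * b)%Z.
      have : (i * w * X r = i * (X r * w))%Z by ring.
      by rewrite wE jE -/c; clear; lia.
    rewrite !iE.
    have [j0|j0] := posnP j.
      exists leg_path; first by rewrite inE eqxx.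
      exists (r + k); first by rewrite size_mkseq /t; clear -kr; lia.
      by move=> z0; left; rewrite -addnS !nth_leg_pathX ?j0 // ltnW.
    have ek : exists k' : nat, k' < h /\ (j = (k' + k').+1 \/ j = (k' + k').+2).
      exists (j.-1)./2; move: jN; rewrite /N; clear -j0; lia.
    case: ek => k' [k'h jk']; exists (Y k'); first exact: LY.
    case: jk' => jk'.
      exists k; first by rewrite size_mkseq /t; clear -kr; lia.
      move=> z0; left; rewrite !nth_zpath; try by clear -kr; rewrite /t; lia.
      by rewrite /doubled kr (ltnW kr) jk'.
    exists (r + k); first by rewrite size_mkseq /t; clear -kr; lia.
    have dE l : doubled (r + l) = (c + X l)%Z.
      rewrite /doubled; case: ifP => [rl|_]; last by rewrite addKn.
      have -> : l = 0 by clear -rl; lia.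
      by rewrite X0 addn0 Z.add_0_r.
    move=> z0; left; rewrite !nth_zpath; try by clear -kr; rewrite /t; lia.
    by rewrite -(addnS r k) !dE jk'; split; apply/option_zvE; exists 0%Z; clear; lia.
  apply: cover_infinity => [d d0 dh a|a].
    have [dt|dt] := ltnP d t.
      by case: (Dcov d d0 dt) => -[k kr kd]; [apply: shiftD kd a | apply: shiftX kd a].
    have dg : t <= d < t + g * t by rewrite dt gtE ltnS.
    by have [p pG ad] := cG d dg a; exists p; rewrite // inE 2!mem_cat pG !orbT.
  have [i iN /option_zvE[q iE]] := zv_repr option_zvE (a - D r.-1) (ltn0Sn h.*2).
  have -> : zv a = zv (i + D r.-1) by apply/option_zvE; exists q; clear -iE; lia.
  have [->|i0] := posnP i; last first.
    by have [p pD ad] := infinity_paths_center D i0 iN; exists p => //; apply: Linf.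
  exists leg_path; first by rewrite inE eqxx.
  exists 0; first by rewrite size_mkseq /t; clear -r0; lia.
  by move=> z0; right; rewrite (@nth_leg_pathD _ 1) ?subn1.
rewrite !size_cat !size_map !size_iota sG -card_infinity card_option card_ord subn1 /=.
by rewrite -{1}gE /N; clear; lia.
Qed.
End Doubling.

(** * Odd [m]: one tripod among the paths *)

Section Tripod.
Variables (D A B : nat -> Z).
Hypotheses (D0 : D 0 = 0%Z) (A0 : A 0 = 0%Z) (B0 : B 0 = 0%Z).

(* Two arms [A] and [B] of [r] steps leaving 0.  All rotations are used as paths
   except the one by 0, which forms a tripod with the leg of infinity. *)
Definition joined (j : nat) : Z := if (j <= r)%nat then A (r - j)%nat else B (j - r)%nat.

Hypothesis Dspread : forall i j, i < j -> j < r -> D i <> D j /\ (Z.abs (D i - D j) < h)%Z.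
Hypothesis Jspread : spread N t joined.
Hypothesis DJspread : forall j k, j <= t -> 0 < k -> k < r ->
  joined j <> D k /\ (Z.abs (joined j - D k) < N)%Z.

Lemma joined_l k : k <= r -> joined (r - k) = A k.
Proof. by move=> kr; rewrite /joined leq_subr subKn. Qed.

Lemma joined_r k : joined (r + k) = B k.
Proof.
rewrite /joined; have [->|k0] := posnP k; first by rewrite addn0 leqnn subnn A0 B0.
by rewrite ifF ?addKn //; clear -k0; lia.
Qed.

Let legA := mkseq (fun j => zv (A j)) r.+1.
Let legB := mkseq (fun j => zv (B j)) r.+1.
Let legC := mkseq (fun j => if j < r then zv (D j) else None) r.+1.

Lemma legA_cons : zv 0 :: behead legA = legA. Proof. by rewrite -[X in zv X]A0. Qed.
Lemma legB_cons : zv 0 :: behead legB = legB. Proof. by rewrite -[X in zv X]B0. Qed.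
Lemma legC_cons : zv 0 :: behead legC = legC.
Proof.
by rewrite -[X in zv X]D0 (_ : zv (D 0) = if 0 < r then zv (D 0) else None) // r0.
Qed.

Lemma tripod_uniq : uniq (zv 0 :: behead legA ++ behead legB ++ behead legC).
Proof.
pose s := rev (behead legA) ++ zv 0 :: behead legB.
have sE : s = zpath zv t 0 joined.
  have szA : size (behead legA) = r by rewrite size_behead size_mkseq.
  apply: (@eq_from_nth _ None).
    by rewrite size_cat size_rev legB_cons szA !size_mkseq /t; clear; lia.
  move=> j; rewrite size_cat size_rev legB_cons szA size_mkseq => jr.
  rewrite nth_zpath; last by move: jr; clear; rewrite /t; lia.
  rewrite nth_cat size_rev szA; have [jr'|jr'] := ltnP j r.
    rewrite nth_rev ?szA // nth_behead nth_mkseq; last by clear -jr'; lia.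
    by rewrite -[j in RHS](subKn (ltnW jr')) joined_l ?leq_subr // subnSK.
  rewrite legB_cons nth_mkseq; last by clear -jr jr'; lia.
  by rewrite -[j in RHS](subnKC jr') joined_r.
have -> : uniq (zv 0 :: behead legA ++ behead legB ++ behead legC) = uniq (s ++ behead legC).
  apply: perm_uniq; rewrite /s -catA perm_sym -cat1s -catA perm_catCA /=.
  by rewrite perm_cons perm_cat2r perm_rev.
rewrite cat_uniq sE (zpath_uniq option_zvE) // andTb; apply/andP; split.
  apply/hasPn=> x /(nthP None)[k]; rewrite size_behead size_mkseq => kr <-.
  rewrite nth_behead nth_mkseq //; apply/negP=> /mapP[j]; rewrite mem_iota /= => jt.
  case: ifP => // kr' /(zv_inj option_zvE).
  by have := DJspread jt (ltn0Sn k) kr'; clear; lia.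
suff : uniq legC by rewrite -legC_cons => /andP[].
apply/(mkseq_uniqP _).
suff main i j : i < j -> j <= r ->
    (if i < r then zv (D i) else None) <> (if j < r then zv (D j) else None).
  move=> j k; rewrite !inE !ltnS => jt kt e.
  by case: (ltngtP j k) => // jk; [case: (main j k) | case: (main k j)].
move=> ij jr; rewrite (leq_trans ij jr); case: ifP => // jr' /(zv_inj option_zvE).
by have := Dspread ij jr'; rewrite /N; clear; lia.
Qed.

(** [D], [A] and [B] together have [3r - 1] steps, one for each difference below [3r]. The remaining
    [r(m - 3)] differences form [(m - 3)/2] blocks of length [t], as [m] is odd. *)
Lemma unparalleled_tripod : odd m ->
  (forall d, 0 < d -> d < 3 * r ->
     [\/ exists2 k : nat, (k.+1 < r)%nat & (D k.+1 = D k + d \/ D k = D k.+1 + d)%Z,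
         exists2 k : nat, (k < r)%nat & (A k.+1 = A k + d \/ A k = A k.+1 + d)%Z |
         exists2 k : nat, (k < r)%nat & (B k.+1 = B k + d \/ B k = B k.+1 + d)%Z]) ->
  exists C : {set {set {set 'I_(2 * t * m)}}}, is_CS (2 * t) C /\ unparalleled C.
Proof.
move=> om Dcov.
have t1 : 1 < t by clear -r0; rewrite /t; lia.
pose g := (m - 3)./2; have gE : m = 3 + g.*2 by clear -om m1; rewrite /g; lia.
have gtE : 3 * r + g * t = h.+1 by rewrite succ_h gE /t; clear; lia.
have [||||G [sG gG cG]] := @packing_zigzags V N zv option_zvE t [set~ None] (3 * r) g.
- by [].
- exact: zv_in.
- by clear -r0; lia.
- by rewrite gtE /N; clear; lia.
pose J (k : nat) := zpath zv t k joined.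
pose P := infinity_paths D ++ [seq J k | k <- iota 1 h.*2] ++ G.
pose L := [:: legA, legB, legC & P].
apply: (@unparalleled_of_paths_spider V t t1 r (zv 0) (erefl _) m None
  (behead legA) (behead legB) (behead legC) P (ltnW m1) card_infinity).
- move=> p; rewrite 2!mem_cat => /or3P[|/mapP[k _ ->]|/gG//].
    exact: infinity_paths_ends.
  split; rewrite ?size_mkseq //; first exact: (zpath_uniq option_zvE).
  by move=> z0; rewrite !nth_mkseq ?zv_in.
- by rewrite size_behead size_mkseq.
- by rewrite size_behead size_mkseq.
- by rewrite size_behead size_mkseq.
- exact: tripod_uniq.
- by rewrite legC_cons nth_mkseq // ltnn.
- rewrite legA_cons legB_cons legC_cons -/L.
  have Linf p : p \in infinity_paths D -> p \in L.
    by move=> pD; rewrite !inE mem_cat pD !orbT.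
  have LJ k : 0 < k -> k < N -> J k \in L.
    by move=> k0 kh; rewrite !inE 2!mem_cat map_f ?orbT // mem_iota k0.
  have shiftD k (d : nat) : k.+1 < r -> (D k.+1 = D k + d \/ D k = D k.+1 + d)%Z ->
      forall a, exists2 p, p \in L & adj p (zv a) (zv (a + d)).
    move=> kr kd a; apply: (@cover_shift L (D k) (D k.+1) d _ kd) => i iN.
    have [->|i0] := posnP i; last first.
      by have [p pD ad] := infinity_paths_arm D i0 iN kr; exists p => //; apply: Linf.
    exists legC; first by rewrite !inE eqxx !orbT.
    exists k; first by rewrite size_mkseq ltnS ltnW.
    by move=> z0; left; rewrite !nth_mkseq ?kr ?(ltnW kr) // ltnS ltnW // ltnW.
  have shiftA k (d : nat) : k < r -> (A k.+1 = A k + d \/ A k = A k.+1 + d)%Z ->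
      forall a, exists2 p, p \in L & adj p (zv a) (zv (a + d)).
    move=> kr kd a; apply: (@cover_shift L (A k) (A k.+1) d _ kd) => i iN.
    have [->|i0] := posnP i; last first.
      exists (J i); first exact: LJ.
      exists (r - k.+1); first by rewrite size_mkseq /t; clear -kr; lia.
      move=> z0; right; have -> : (r - k.+1).+1 = r - k by clear -kr; lia.
      rewrite !nth_zpath; try by clear -kr; rewrite /t; lia.
      by rewrite !joined_l // ltnW.
    exists legA; first by rewrite !inE eqxx.
    exists k; first by rewrite size_mkseq.
    by move=> z0; left; rewrite !nth_mkseq // ltnW.
  have shiftB k (d : nat) : k < r -> (B k.+1 = B k + d \/ B k = B k.+1 + d)%Z ->
      forall a, exists2 p, p \in L & adj p (zv a) (zv (a + d)).
    move=> kr kd a; apply: (@cover_shift L (B k) (B k.+1) d _ kd) => i iN.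
    have [->|i0] := posnP i; last first.
      exists (J i); first exact: LJ.
      exists (r + k); first by rewrite size_mkseq /t; clear -kr; lia.
      move=> z0; left; rewrite -(addnS r k).
      rewrite !nth_zpath; try by clear -kr; rewrite /t; lia.
      by rewrite !joined_r.
    exists legB; first by rewrite !inE eqxx ?orbT.
    exists k; first by rewrite size_mkseq.
    by move=> z0; left; rewrite !nth_mkseq // ltnW.
  apply: cover_infinity => [d d0 dh a|a].
    have [dt|dt] := ltnP d (3 * r).
      case: (Dcov d d0 dt) => -[k kr kd];
        [exact: shiftD kd a | exact: shiftA kd a | exact: shiftB kd a].
    have dg : 3 * r <= d < 3 * r + g * t by rewrite dt gtE ltnS.
    by have [p pG ad] := cG d dg a; exists p; rewrite // !inE 2!mem_cat pG !orbT.
  have [i iN /option_zvE[q iE]] := zv_repr option_zvE (a - D r.-1) (ltn0Sn h.*2).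
  have -> : zv a = zv (i + D r.-1) by apply/option_zvE; exists q; clear -iE; lia.
  have [->|i0] := posnP i; last first.
    by have [p pD ad] := infinity_paths_center D i0 iN; exists p => //; apply: Linf.
  exists legC; first by rewrite !inE eqxx !orbT.
  exists r.-1; first by rewrite size_mkseq prednK.
  have r1 : r.-1 < r by rewrite prednK.
  by move=> z0; left; rewrite prednK // !nth_mkseq // ?ltnS ?leq_pred // r1 ltnn.
rewrite !size_cat !size_map !size_iota sG -card_infinity card_option card_ord subn1 /=.
by rewrite gE /N; clear; lia.
Qed.
End Tripod.

End Infinity.

(** * Explicit walks for even [t] *)

Lemma alternating_sum_spread delta l M :
  (forall k, k.+1 < l -> delta k.+1 < delta k) -> (forall k, k < l -> 0 < delta k <= M) ->
  (forall j, j <= l -> (0 <= alternating_sum delta j <= M)%Z) /\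
  (forall i j, i < j -> j <= l ->
     alternating_sum delta i <> alternating_sum delta j /\
     (Z.abs (alternating_sum delta i - alternating_sum delta j) <= M)%Z).
Proof.
move=> decr bnd; have pos k : k < l -> 0 < delta k by move=> /bnd/andP[].
have nested i j ij jl := alternating_sum_nested decr pos (i := i) (j := j) ij jl.
split=> [[|j] jl|i j ij jl]; first by rewrite /=; lia.
  have : (1 <= alternating_sum delta j.+1 - 0 <= delta 0%nat)%Z := nested 0 j.+1 isT jl.
  by have := bnd 0 (leq_ltn_trans (leq0n j) jl); lia.
by have := nested i j ij jl; have := bnd i (leq_trans ij jl); case: (odd i); lia.
Qed.

Lemma alternating_sum_step delta k :
  (alternating_sum delta k.+1 = alternating_sum delta k + delta k \/
   alternating_sum delta k = alternating_sum delta k.+1 + delta k)%Z.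
Proof. by rewrite /=; case: (odd k); lia. Qed.

(* Arm 1 steps over the differences [2r, .., r + 1] and arm 2 over
   [r, 2r + 1, .., 3r - 1]; both avoid [1 .. r - 1], where the leg of infinity is. *)
Definition tripod_arm1 (r j : nat) : Z := if odd j then (j./2 - 2 * r)%Z else (- j./2)%Z.

Definition tripod_arm2 (r j : nat) : Z :=
  if odd j then (r + j./2)%Z else if j is 0 then 0%Z else (- (r + j./2))%Z.

Lemma tripod_arm1P r j : exists k : nat,
  j = k + k /\ tripod_arm1 r j = (- k)%Z \/
  j = (k + k).+1 /\ tripod_arm1 r j = (k - 2 * r)%Z.
Proof. by exists j./2; rewrite /tripod_arm1; case: ifP => oj; lia. Qed.

Lemma tripod_arm2P r j : exists k : nat,
  [\/ j = 0 /\ tripod_arm2 r j = 0%Z,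
      0 < k /\ j = k + k /\ tripod_arm2 r j = (- (r + k))%Z |
      j = (k + k).+1 /\ tripod_arm2 r j = (r + k)%Z].
Proof.
exists j./2; rewrite /tripod_arm2; case: ifP => oj; first by constructor 3; lia.
by case: j oj => [|j] oj; [constructor 1 | constructor 2]; lia.
Qed.

(** [D] takes the steps [r - 1] down to 1. After its start it stays in [[1, r - 1]], an interval
    that both arms avoid. *)
Lemma unparalleled_even_odd r m : 0 < r -> odd m -> 1 < m ->
  exists C : {set {set {set 'I_(2 * r.*2 * m)}}}, is_CS (2 * r.*2) C /\ unparalleled C.
Proof.
move=> r0 om m1; have m3 : 2 < m by clear -om m1; lia.
pose delta j := r - j.+1; pose D := alternating_sum delta.
pose h := (r * m).-1.
have hE : h.+1 = r * m by rewrite /h prednK // muln_gt0 r0 ltnW.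
have hr : 3 * r <= h.+1 by rewrite hE mulnC leq_mul2l m3 orbT.
have [||Drange Dspread] := @alternating_sum_spread delta r.-1 r.-1.
- by rewrite /delta; clear; lia.
- by rewrite /delta; clear; lia.
rewrite -/D in Drange Dspread.
pose J := joined r (tripod_arm1 r) (tripod_arm2 r).
have JE j : exists k : nat, (j <= r /\ k = r - j /\ J j = tripod_arm1 r k) \/
    (r < j /\ k = j - r /\ J j = tripod_arm2 r k).
  rewrite /J /joined; have [jr|jr] := leqP j r; first by exists (r - j); left.
  by exists (j - r); right.
apply: (@unparalleled_tripod r m r0 m1 D (tripod_arm1 r) (tripod_arm2 r)) => //.
- move=> i j ij jr; have jr' : j <= r.-1 by clear -jr; lia.
  by have := Dspread i j ij jr'; rewrite -/h; clear -hr r0; lia.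
- move=> i j ij jt; rewrite -/J -/h.
  have [a [[ar [aE ->]]|[ar [aE ->]]]] := JE i; have [b [[br [bE ->]]|[br [bE ->]]]] := JE j.
  + have [k kE] := tripod_arm1P r a; have [l lE] := tripod_arm1P r b.
    by clear -hr r0 ij jt ar br aE bE kE lE; lia.
  + have [k kE] := tripod_arm1P r a; have [l lE] := tripod_arm2P r b.
    by clear -hr r0 ij jt ar br aE bE kE lE; case: lE; lia.
  + by clear -ar br ij; lia.
  have [k kE] := tripod_arm2P r a; have [l lE] := tripod_arm2P r b.
  by clear -hr r0 ij jt ar br aE bE kE lE; case: lE; case: kE; lia.
- move=> j k jt k0 kr; rewrite -/J -/h.
  have k1 : k <= r.-1 by clear -kr; lia.
  have D1 := Dspread 0 k k0 k1; have D2 := Drange k k1; have D00 : D 0 = 0%Z by [].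
  rewrite D00 in D1 D2; clear Drange Dspread.
  have [a [[ar [aE ->]]|[ar [aE ->]]]] := JE j.
    by have [l lE] := tripod_arm1P r a; clear -hr r0 jt ar aE lE D1 D2; lia.
  by have [l lE] := tripod_arm2P r a; clear -hr r0 jt ar aE lE D1 D2; case: lE; lia.
move=> d d0 d3; have [dr|dr] := ltnP d r.
  constructor 1; exists (r - d.+1); first by clear -dr d0; lia.
  have -> : (d : Z) = delta (r - d.+1) by rewrite /delta; clear -dr d0; lia.
  exact: alternating_sum_step.
have [d2|d2] := leqP d (2 * r).
  have [->|dr'] := eqVneq d r.
    by constructor 3; exists 0; rewrite // /tripod_arm2 /=; left; lia.
  constructor 2; exists (2 * r - d); first by clear -dr d2 dr'; lia.
  have [k kE] := tripod_arm1P r (2 * r - d); have [l lE] := tripod_arm1P r (2 * r - d).+1.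
  by clear -dr d2 dr' kE lE; lia.
constructor 3; exists (d - 2 * r); first by clear -d2 d3; lia.
have [k kE] := tripod_arm2P r (d - 2 * r); have [l lE] := tripod_arm2P r (d - 2 * r).+1.
by clear -dr d2 d3 kE lE; case: kE; case: lE; lia.
Qed.

(** [D] takes the steps [r - 1] down to 1 and the zigzag [X] the steps [r] to [2r - 1]. As [r] is
    even, [X] ends at [-s]. *)
Lemma unparalleled_even_even_half_even r s m : r = s.*2 -> 0 < r -> ~~ odd m -> 1 < m ->
  exists C : {set {set {set 'I_(2 * r.*2 * m)}}}, is_CS (2 * r.*2) C /\ unparalleled C.
Proof.
move=> rE r0 em m1.
pose delta j := r - j.+1; pose D := alternating_sum delta.
pose h := (r * m).-1.
have hE : h.+1 = r * m by rewrite /h prednK // muln_gt0 r0 ltnW.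
have hr : 2 * r <= h.+1 by rewrite hE mulnC leq_mul2l m1 orbT.
have [||Drange Dspread] := @alternating_sum_spread delta r.-1 r.-1.
- by rewrite /delta; clear; lia.
- by rewrite /delta; clear; lia.
rewrite -/D in Drange Dspread.
have X_r : zigzag r r = (- s)%Z by case: zigzagP => k kE; clear -kE rE; lia.
apply: (@unparalleled_doubling r m r0 m1 D (zigzag r)) => //.
- move=> i j ij jr; have jr' : j <= r.-1 by clear -jr; lia.
  by have := Dspread i j ij jr'; rewrite -/h; clear -hr r0; lia.
- move=> i j ij jt; rewrite -/h /doubled X_r.
  have [ir|ir] := leqP i r; have [jr|jr] := leqP j r; do 2 case: zigzagP => ? ?;
    clear Drange Dspread em m1 hE; lia.
- move=> j k j0 jr kr; rewrite -/h.
  have k1 : k <= r.-1 by clear -kr; lia.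
  have D2 := Drange k k1; clear Drange Dspread.
  by case: zigzagP => l lE; clear -hr r0 j0 jr lE D2; lia.
(* [(-s)(-4m) = 2rm], which is 1 modulo [N = 2rm - 1]. *)
- exists (- (4 * m))%Z, 1%Z; rewrite X_r -/h; clear -hE rE; nia.
move=> d d0 dt; have [dr|dr] := ltnP d r.
  left; exists (r - d.+1); first by clear -dr d0; lia.
  have -> : (d : Z) = delta (r - d.+1) by rewrite /delta; clear -dr d0; lia.
  exact: alternating_sum_step.
right; exists (d - r); first by clear -dt dr; lia.
by have := @zigzag_diff r (d - r) r0; clear -dr; lia.
Qed.

(** For odd [r] the zigzag above would end at [r + s], which need not be invertible modulo [N].
    Instead [X] takes the steps [r + 1] to [2r - 1] and then goes from [-s] to [-r], a step of
    [s + 1]; its end is invertible because [(-r)(-2m) = 2rm]. [D] takes the steps [r] down to 1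
    without [s + 1]. *)
Lemma unparalleled_even_even_half_odd r s m : r = s.*2.+1 -> ~~ odd m -> 1 < m ->
  exists C : {set {set {set 'I_(2 * r.*2 * m)}}}, is_CS (2 * r.*2) C /\ unparalleled C.
Proof.
move=> rE em m1; have r0 : 0 < r by rewrite rE.
pose delta j := if j < s then r - j else r - j.+1; pose D := alternating_sum delta.
pose h := (r * m).-1.
have hE : h.+1 = r * m by rewrite /h prednK // muln_gt0 r0 ltnW.
have hr : 2 * r <= h.+1 by rewrite hE mulnC leq_mul2l m1 orbT.
have [||Drange Dspread] := @alternating_sum_spread delta r.-1 r.
- by rewrite /delta => k kr; do 2 case: ifP; clear -kr rE; lia.
- by rewrite /delta => k kr; case: ifP; clear -kr rE; lia.
rewrite -/D in Drange Dspread.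
pose X (j : nat) : Z := if j == r then (- r)%Z else zigzag r.+1 j.
have XP j : j <= r -> exists k : nat, [\/ j = r /\ X j = (- r)%Z,
    j < r /\ j = k + k /\ X j = (- k)%Z | j < r /\ j = (k + k).+1 /\ X j = (r.+1 + k)%Z].
  move=> jr; rewrite /X; have [->|jr'] := eqVneq j r; first by exists 0; constructor 1.
  have {jr jr'} jr : j < r by rewrite ltn_neqAle jr' jr.
  by case: zigzagP => k kE; exists k; [constructor 2 | constructor 3].
have X_r : X r = (- r)%Z by rewrite /X eqxx.
apply: (@unparalleled_doubling r m r0 m1 D X) => //.
- by rewrite /X; case: eqP => // r00; move: r0; rewrite -r00.
- move=> i j ij jr; have jr' : j <= r.-1 by clear -jr; lia.
  by have := Dspread i j ij jr'; rewrite -/h; clear -hr r0 rE ij jr; lia.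
- move=> i j ij jt; rewrite -/h /doubled X_r.
  have [ir|ir] := leqP i r; have [jr|jr] := leqP j r.
  + have [k kE] := XP i ir; have [l lE] := XP j jr.
    by clear -kE lE rE hr ij; case: kE; case: lE; lia.
  + have jr' : j - r <= r by clear -jt; lia.
    have [k kE] := XP i ir; have [l lE] := XP (j - r) jr'.
    by clear -kE lE rE hr ij jr; case: kE; case: lE; lia.
  + by clear -ir jr ij; lia.
  have jr' : j - r <= r by clear -jt; lia.
  have ir' : i - r <= r by clear -jt ij; lia.
  have [k kE] := XP (i - r) ir'; have [l lE] := XP (j - r) jr'.
  by clear -kE lE rE hr ij jr ir; case: kE; case: lE; lia.
- move=> j k j0 jr kr; rewrite -/h.
  have k1 : k <= r.-1 by clear -kr; lia.
  have D2 := Drange k k1; clear Drange Dspread.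
  by have [l lE] := XP j jr; clear -hr r0 rE j0 jr lE D2; case: lE; lia.
- exists (- (2 * m))%Z, 1%Z; rewrite X_r -/h; clear -hE; nia.
move=> d d0 dt; have [dr|dr] := leqP d r.
  have [ds|ds] := eqVneq d s.+1.
    right; exists s.*2; first by rewrite rE.
    have [|k kE] := XP s.*2; first by clear -rE; lia.
    have [|l lE] := XP s.*2.+1; first by clear -rE; lia.
    by clear -kE lE rE ds; case: kE; case: lE; lia.
  left; exists (if d <= s then r - d.+1 else r - d); first by case: ifP; clear -rE d0 dr ds; lia.
  have -> : (d : Z) = delta (if d <= s then r - d.+1 else r - d).
    by rewrite /delta; have [e1|e1] := leqP d s; case: ifP; clear -e1 rE d0 dr ds; lia.
  exact: alternating_sum_step.
right; exists (d - r.+1); first by clear -dt dr; lia.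
have k1 : d - r.+1 < s.*2 by clear -dt dr rE; lia.
have := @zigzag_diff r.+1 (d - r.+1) isT.
by rewrite /X !ifF; clear -dr k1 rE; lia.
Qed.

(** * The parity cases put together *)

Lemma exists_unparalleled t m : 1 < t -> 1 < m ->
  exists C : {set {set {set 'I_(2 * t * m)}}}, is_CS (2 * t) C /\ unparalleled C.
Proof.
move=> t1 m1; have [ot|et] := boolP (odd t); have [om|em] := boolP (odd m).
- exact: unparalleled_odd_odd.
- exact: unparalleled_odd_even.
- have -> : t = t./2.*2 by clear -et; lia.
  by apply: unparalleled_even_odd => //; clear -t1; lia.
have -> : t = t./2.*2 by clear -et; lia.
have [or|er] := boolP (odd t./2).
  by apply: (@unparalleled_even_even_half_odd _ t./2./2) => //; clear -or; lia.
by apply: (@unparalleled_even_even_half_even _ t./2./2) => //; [clear -er | clear -t1]; lia.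
Qed.

Theorem theorem1p1 (v t : nat) (hv : 0 < v) (ht : 0 < t)
    (hvt : v = 0 %[mod 2 * t]) :
  (exists C : {set {set {set 'I_v}}}, is_CS (2 * t) C /\ unparalleled C)
  <-> (2 * t < v /\ 2 < 2 * t).
Proof.
split=> [[C [CS unp]]|[tv t2]].
  have [k3 kv _] := CS; split=> //; rewrite ltn_neqAle kv andbT; apply/eqP=> e.
  by subst v; apply: no_unparalleled_hamiltonian CS unp; rewrite oddM.
have /dvdnP[m] : 2 * t %| v by rewrite /dvdn hvt mod0n.
rewrite mulnC => vE; subst v; apply: exists_unparalleled; first by clear -t2; lia.
by move: tv; rewrite -{1}[2 * t]muln1 ltn_mul2l => /andP[].
Qed.
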